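(* $\displaystyle\sum_{v\in\overline V_n}\mathsf d_{G_n}(1,v)=(d_n^*+\lambda_n)n+o_p\Big(\frac{n}{\log\log n}\Big)$, i.e. $\frac{\log\log n}{n}\Big|\sum_{v\in\overline V_n}\mathsf d_{G_n}(1,v)-(d_n^*+\lambda_n)n\Big|\to0$ in probability.
   Context: Let $(\alpha_n)$ be a sequence in $(0,\infty)$ with $0<\liminf\alpha_n\le\limsup\alpha_n<\infty$, $q_n=\alpha_n\log n/n$, $G_n\sim\mathcal G(n,q_n)$ on $\{1,\dots,n\}$, $d_n^*=\min\{d\in\mathbb Z:(nq_n)^d\ge n/(\log\log n)^2\}$, $\lambda_n\in(0,1)$ with $\log(1/\lambda_n)=(nq_n)^{d_n^*}/n$, and $\overline V_n$ the vertex set of the connected component of $G_n$ containing vertex $1$. *)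

(* Defs.v *)
From HB Require Import structures.
From mathcomp Require Import all_boot all_order all_algebra.
From mathcomp Require Import all_classical all_reals all_analysis.

Set Implicit Arguments.
Unset Strict Implicit.
Unset Printing Implicit Defensive.

Import Order.TTheory GRing.Theory Num.Theory.
Import numFieldNormedType.Exports.

Local Open Scope classical_set_scope.
Local Open Scope ring_scope.

Section Distance.
Variables (T : finType) (e : rel T).

Definition walk (u v : T) (k : nat) : bool :=
  [exists p : k.-tuple T, path e u p && (last u p == v)].

(* The value 0 for disconnected pairs is a dummy: it is never used below,
   where distances are only summed over a connected component. *)
Definition gdist (u v : T) : nat :=
  if pselect (exists k, walk u v k) is left h then ex_minn h else 0%N.

Definition component (u : T) : {set T} := finset (connect e u).

End Distance.

(* For n >= 1 this is 'I_n; the predecessor-successor makes the type inhabited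
   for every n. The vertices 1, ..., n are numbered 0, ..., n-1. *)
Definition vertex (n : nat) : finType := 'I_n.-1.+1.

Definition vertex1 (n : nat) : vertex n := ord0.

Definition vertex_pairs (n : nat) : {set {set vertex n}} :=
  finset (fun f : {set vertex n} => #|f| == 2).

(* A simple graph on the vertices is represented by its edge set
   E \subset vertex_pairs n. *)
Definition adj (n : nat) (E : {set {set vertex n}}) : rel (vertex n) :=
  fun u v => [set u; v]%SET \in E.

Section ErdosRenyi.
Variables (R : realType) (n : nat) (q : R).

(* Each pair of vertices is an edge with probability q, independently. *)
Definition ER_weight (E : {set {set vertex n}}) : R :=
  \prod_(f in vertex_pairs n) (if f \in E then q else 1 - q).

Definition ER_prob (A : pred {set {set vertex n}}) : R :=
  \sum_(E in powerset (vertex_pairs n) | A E) ER_weight E.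

End ErdosRenyi.

Definition dist_sum (n : nat) (E : {set {set vertex n}}) : nat :=
  (\sum_(v in component (adj E) (vertex1 n)) gdist (adj E) (vertex1 n) v)%N.

Definition edge_prob (R : realType) (alpha : nat -> R) (n : nat) : R :=
  alpha n * ln n%:R / n%:R.

(* d is the least integer with (n q)^d >= n / (log log n)^2; this is an integer
   power, and such a minimum exists as soon as n q > 1 and n > 2. *)
Definition is_dstar (R : realType) (n : nat) (q : R) (d : int) : Prop :=
  let D := [set k : int | n%:R / (ln (ln n%:R)) ^+ 2 <= (n%:R * q) ^ k] in
  D d /\ lbound D d.

(* For random variables X n on the space of G(n, q n), n = 1, 2, ... *)
Definition ER_cvg_in_prob0 (R : realType) (q : nat -> R)
    (X : forall n, {set {set vertex n}} -> R) : Prop :=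
  forall eps : R, 0 < eps ->
    ER_prob (q n) (fun E : {set {set vertex n}} => eps < `|X n E|)
      @[n --> \oo] --> (0 : R).

(* Main.v *)
(** Explore the graph from vertex 1 by breadth-first search: u_k vertices lie
    outside the ball of radius k, s_k on its sphere, and D = n q is the mean
    degree. Given the first k balls, each outside vertex is missed by the next
    ball independently with probability (1 - q)^{s_k}. Hence s_k / D^k is a
    martingale up to a depletion error of order D^k / n, and in L^1 it stays
    within O(D^{-1/2} + D^k / n) of 1. At the radius d - 1, where d = d*, this is
    O(1 / (log log n)^2), so the binomial step to radius d leaves
    u_d = (lambda + o(1 / log log n)) n. One more step leaves only n / (log n)^2
    vertices, and from then on the spheres shrink geometrically in mean. The sum
    of the distances is the sum over k of (u_k - u_oo): the d terms k < d give d n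
    up to the total size of the balls of radius below d, which is O(n / (log log
    n)^2), the term k = d gives lambda n, and the others are negligible. *)

Require Import Defs.
From HB Require Import structures.
From mathcomp Require Import all_boot all_order all_algebra.
From mathcomp Require Import all_classical all_reals all_analysis.
From mathcomp Require Import ring lra.
(* Restores the finite-set lemmas that classical_sets shadows. *)
Import mathcomp.boot.fintype mathcomp.boot.finset.

Set Implicit Arguments.
Unset Strict Implicit.
Unset Printing Implicit Defensive.

Import Order.TTheory GRing.Theory Num.Theory.
Import numFieldNormedType.Exports.

Local Open Scope ring_scope.

(** * Random subsets *)

Section RandomSubset.
Variables (R : realType) (T : finType) (A : {set T}) (q : R).

Definition subset_weight (W : {set T}) : R :=
  \prod_(f in A) (if f \in W then q else 1 - q).

Definition subset_mean (X : {set T} -> R) : R :=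
  \sum_(W in powerset A) subset_weight W * X W.

(** Expand the product of [F i + G i] over all of [T]. Setting [F] to 0 off [A] kills the subsets
    that are not contained in [A]. *)
Lemma subset_weight_sum : \sum_(W in powerset A) subset_weight W = 1.
Proof.
pose F i : R := if i \in A then q else 0.
pose G i : R := if i \in A then 1 - q else 1.
have <- : \prod_i (F i + G i) = 1.
  by rewrite big1// => i _; rewrite /F /G; case: ifP => _; rewrite ?add0r//; ring.
rewrite bigA_distr big_mkcond; apply: eq_bigr => W _ /=.
rewrite powersetE; case: ifPn => [WA|].
  rewrite /subset_weight big_mkcond; apply: eq_bigr => i _.
  rewrite /F /G; case: (boolP (i \in A)) => // iA.
  by case: ifP => // /(subsetP WA); rewrite (negPf iA).
case/subsetPn => i iW iA; apply/esym/eqP/prodf_eq0; exists i => //.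
by rewrite iW /F (negPf iA).
Qed.

Lemma eq_subset_mean X Y : (forall W, X W = Y W) ->
  subset_mean X = subset_mean Y.
Proof. by move=> XY; apply: eq_bigr => W _; rewrite XY. Qed.

Lemma subset_meanD X Y :
  subset_mean (fun W => X W + Y W) = subset_mean X + subset_mean Y.
Proof. by rewrite -big_split; apply: eq_bigr => W _; rewrite mulrDr. Qed.

Lemma subset_meanZ c X : subset_mean (fun W => c * X W) = c * subset_mean X.
Proof. by rewrite [RHS]mulr_sumr; apply: eq_bigr => W _; rewrite mulrCA. Qed.

Lemma subset_meanN X : subset_mean (fun W => - X W) = - subset_mean X.
Proof.
by rewrite -mulN1r -subset_meanZ; apply: eq_subset_mean => W; rewrite mulN1r.
Qed.

Lemma subset_meanB X Y :
  subset_mean (fun W => X W - Y W) = subset_mean X - subset_mean Y.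
Proof. by rewrite subset_meanD subset_meanN. Qed.

Lemma subset_mean_sum (I : Type) (r : seq I) (P : pred I)
    (X : I -> {set T} -> R) :
  subset_mean (fun W => \sum_(i <- r | P i) X i W) =
  \sum_(i <- r | P i) subset_mean (X i).
Proof.
by rewrite exchange_big/=; apply: eq_bigr => W _; rewrite mulr_sumr.
Qed.

Lemma subset_mean_cst c : subset_mean (fun=> c) = c.
Proof. by rewrite /subset_mean -mulr_suml subset_weight_sum mul1r. Qed.

(* Independence of the coordinate f from the others, in the form of the pairing
   of W with W \cup {f}. *)
Lemma subset_mean_notin f G : f \in A ->
    (forall W, G (f |: W) = G (W :\ f)) ->
  subset_mean (fun W => G W * (f \notin W)%:R) = (1 - q) * subset_mean G.
Proof.
move=> fA Gf.
pose P (W : {set T}) : R :=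
  \prod_(i in A | i != f) (if i \in W then q else 1 - q).
have wE W : subset_weight W = (if f \in W then q else 1 - q) * P W.
  by rewrite /subset_weight (bigD1 f).
have PE W : P (f |: W) = P W.
  by apply: eq_bigr => i /andP[_ /negPf ni]; rewrite !inE ni.
have -> : subset_mean G =
    \sum_(W in powerset A | f \notin W) P W * G W.
  rewrite /subset_mean (bigID (fun W : {set T} => f \in W))/= addrC.
  rewrite [X in _ + X](_ : _ =
      \sum_(W in powerset A | f \notin W) q * P W * G W); last first.
    rewrite (reindex_onto (fun W => f |: W) (fun W => W :\ f))/=.
      apply: eq_big => W.
        rewrite !powersetE setU11 andbT subUset sub1set fA /=.
        case: (boolP (f \in W)) => fW.
          rewrite andbF; apply/negbTE; rewrite negb_and; apply/orP; right.
          by apply/eqP => h; move: fW; rewrite -h !inE eqxx.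
        by rewrite setU1K ?eqxx.
      by move=> /andP[_ /eqP h]; rewrite wE setU11 PE -[in G W]h -Gf setUA setUid.
    by move=> W /andP[_ fW]; rewrite setD1K.
  rewrite -big_split/=; apply: eq_bigr => W /andP[_ fW].
  by rewrite wE (negPf fW); ring.
rewrite mulr_sumr /subset_mean [LHS](bigID (fun W : {set T} => f \in W))/= big1 ?add0r.
  by apply: eq_bigr => W /andP[_ fW]; rewrite wE (negPf fW)/=; ring.
by move=> W /andP[_ ->]; rewrite !mulr0.
Qed.

(** Peel off the coordinates of [C] one at a time: [G] times the indicator of missing [C :\ f] does
    not depend on [f]. The hypothesis on [G] says that it only sees [W] outside [C]. *)
Lemma subset_mean_avoid (C : {set T}) G : C \subset A ->
    (forall W W', (W :\: C = W' :\: C) -> G W = G W') ->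
  subset_mean (fun W => G W * [disjoint C & W]%:R) =
  (1 - q) ^+ #|C| * subset_mean G.
Proof.
have [m] := ubnP #|C|; elim: m C G => // m IH C G Cm CA GC.
have [->|[f fC]] := set_0Vmem C.
  rewrite cards0 expr0 mul1r; apply: eq_subset_mean => W.
  by rewrite -setI_eq0 set0I eqxx mulr1.
rewrite (cardsD1 f) fC exprS -mulrA -IH.
- rewrite -(@subset_mean_notin f) ?(subsetP CA)//.
    apply: eq_subset_mean => W.
    rewrite -mulrA -natrM mulnb -{1}(setD1K fC) -setI_eq0 setIUl setU_eq0.
    by rewrite !setI_eq0 disjoints1 andbC.
  move=> W; congr (_ * (nat_of_bool _)%:R).
    by apply: GC; apply/setP => x; rewrite !inE; case: eqP => // ->; rewrite fC.
  rewrite -!setI_eq0; congr (_ == _).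
  by apply/setP => x; rewrite !inE; case: (x == f).
- by move: Cm; rewrite (cardsD1 f) fC.
- exact: fintype.subset_trans (subD1set _ _) CA.
- move=> W W' h; apply: GC.
  by rewrite -(setD1K fC) setUC -!setDDl h.
Qed.

Hypothesis q01 : 0 <= q <= 1.

Lemma subset_weight_ge0 W : 0 <= subset_weight W.
Proof.
by case/andP: q01 => q0 q1; apply: prodr_ge0 => i _; case: ifP; rewrite ?subr_ge0.
Qed.

Lemma le_subset_mean X Y : (forall W, X W <= Y W) ->
  subset_mean X <= subset_mean Y.
Proof.
by move=> XY; apply: ler_sum => W _; rewrite ler_wpM2l ?subset_weight_ge0.
Qed.

Lemma subset_mean_ge0 X : (forall W, 0 <= X W) -> 0 <= subset_mean X.
Proof. by move=> X0; apply: sumr_ge0 => W _; rewrite mulr_ge0 ?subset_weight_ge0. Qed.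

Lemma subset_mean_markov X (P : pred {set T}) t : 0 < t ->
    (forall W, 0 <= X W) -> (forall W, P W -> t <= X W) ->
  subset_mean (fun W => (P W)%:R) <= subset_mean X / t.
Proof.
move=> t0 X0 PX; rewrite mulrC -subset_meanZ; apply: le_subset_mean => W.
rewrite mulrC; case: (boolP (P W)) => [/PX|_]; last by rewrite divr_ge0// ltW.
by rewrite ler_pdivlMr// mul1r.
Qed.

(* AM-GM: |X| <= (t + X^2 / t) / 2. *)
Lemma subset_mean_norm_le X t : 0 < t ->
  subset_mean (fun W => X W ^+ 2) <= t ^+ 2 ->
  subset_mean (fun W => `|X W|) <= t.
Proof.
move=> t0 Xt.
have -> : t = subset_mean (fun=> t / 2) + (2 * t)^-1 * t ^+ 2.
  by rewrite subset_mean_cst; field; rewrite gt_eqF.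
apply: le_trans (_ : _ <= subset_mean (fun=> t / 2) +
    (2 * t)^-1 * subset_mean (fun W => X W ^+ 2)) _; last first.
  by rewrite lerD2l ler_wpM2l// invr_ge0; lra.
rewrite -subset_meanZ -subset_meanD; apply: le_subset_mean => W.
rewrite -[X W ^+ 2]real_normK ?num_real//; set y := `|X W|.
rewrite -subr_ge0 (_ : _ - _ = (y - t) ^+ 2 / (2 * t)).
  by rewrite divr_ge0 ?sqr_ge0//; lra.
by field; rewrite gt_eqF.
Qed.

End RandomSubset.

(** * Balls and distances *)

Section Balls.
Variables (T : finType) (e : rel T) (x : T).

Fixpoint gball (k : nat) : {set T} :=
  if k is j.+1 then gball j :|: [set v | [exists u in gball j, e u v]]
  else [set x].

Definition gsphere (k : nat) : {set T} :=
  if k is j.+1 then gball k :\: gball j else [set x].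

Lemma gball_sub i j : (i <= j)%N -> gball i \subset gball j.
Proof.
move=> /subnKC <-; elim: (j - i)%N => [|m IH]; first by rewrite addn0.
by rewrite addnS; apply: fintype.subset_trans IH (finset.subsetUl _ _).
Qed.

Lemma gsphere_sub_gball k : gsphere k \subset gball k.
Proof. by case: k => //= k; apply: subsetDl. Qed.

Lemma gball_notin_gsphere j k u : (j < k)%N -> u \in gball j -> u \notin gsphere k.
Proof.
case: k => // k jk uj; rewrite !inE negb_and negbK; apply/orP; left.
exact: subsetP (gball_sub (jk : (j <= k)%N)) _ uj.
Qed.

(** Neighbours of a ball of smaller radius already lie in [gball k], so only edges from the sphere
    can reach a new vertex. *)
Lemma notin_gballS k v : v \notin gball k ->
  (v \notin gball k.+1) = [forall s in gsphere k, ~~ e s v].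
Proof.
move=> vk; rewrite !inE (negPf vk) negb_exists; apply/eq_forallb => u.
rewrite implybE -negb_and; congr negb; apply/idP/idP => /andP[uk uv]; rewrite uv andbT.
  case: k vk uk => [|k] // vk uk; rewrite in_setD uk andbT.
  apply: contra vk => ukk; rewrite in_setU; apply/orP; right.
  by rewrite inE; apply/existsP; exists u; rewrite ukk.
exact: subsetP (gsphere_sub_gball k) _ uk.
Qed.

Lemma gballP v k : reflect (exists2 j, (j <= k)%N & walk e x v j) (v \in gball k).
Proof.
apply: (iffP idP) => [|[j jk w]].
  elim: k v => [|k IH] v; rewrite !inE.
    by move=> /eqP ->; exists 0%N => //; apply/existsP; exists [tuple]; rewrite /= eqxx.
  case/orP => [/IH[j jk w]|/existsP[u /andP[/IH[j jk /existsP[p]]]]].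
    by exists j => //; apply: leqW.
  move=> /andP[xp /eqP pu] uv; exists j.+1 => //; apply/existsP.
  exists [tuple of rcons p v].
  by rewrite /= rcons_path last_rcons eqxx andbT xp pu.
apply: subsetP (gball_sub jk) _ _; case/existsP: w => -[p /= /eqP <-].
elim/last_ind: p v {jk} => [|p u IH] v; first by rewrite /= inE eq_sym.
rewrite rcons_path last_rcons size_rcons => /andP[/andP[xp pu] /eqP <-].
rewrite !inE; apply/orP; right; apply/existsP; exists (last x p).
by rewrite pu IH ?xp ?eqxx.
Qed.

(** A path can be shortened to one without repeated vertices, whose length is below [#|T|]. *)
Lemma component_gball N : (#|T| <= N)%N -> component e x = gball N.
Proof.
move=> TN; apply/setP => v; rewrite inE; apply/connectP/gballP.
  case=> p /shortenP[p' xp' up' _] ->; exists (size p').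
    by move/card_uniqP: up' => /= h; apply: ltnW; apply: leq_trans TN;
       rewrite -h; apply: max_card.
  by apply/existsP; exists (in_tuple p'); rewrite /= xp' eqxx.
by case=> j _ /existsP[p /andP[xp /eqP <-]]; exists p.
Qed.

(** Membership in the component rules out the dummy value 0 of [gdist]. *)
Lemma gdist_le v k : v \in component e x -> (gdist e x v <= k)%N = (v \in gball k).
Proof.
rewrite (component_gball (leqnn _)) => /gballP[j _ w].
rewrite /gdist; case: pselect => [h|[]]; last by exists j.
case: ex_minnP => m wm min; apply/idP/gballP => [mk|[i ik wi]]; first by exists m.
exact: leq_trans (min _ wi) ik.
Qed.

(** Layer-cake formula: a distance is the number of radii [k < N] whose ball misses the vertex; then
    exchange the two sums. *)
Lemma sum_gdist N : (#|T| <= N)%N ->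
  (\sum_(v in component e x) gdist e x v =
   \sum_(k < N) (#|gball N| - #|gball k|))%N.
Proof.
move=> TN; transitivity
    (\sum_(v in component e x) \sum_(k < N) (v \notin gball k : nat))%N.
  apply: eq_bigr => v vc.
  have gN : (gdist e x v <= N)%N by rewrite gdist_le// -component_gball.
  under eq_bigr => k _ do rewrite -gdist_le// -ltnNge.
  elim: N {TN} gN => [|N IH]; first by rewrite leqn0 big_ord0 => /eqP.
  rewrite big_ord_recr/= leq_eqVlt => /orP[/eqP gN|gN].
    rewrite gN ltnSn; under eq_bigr => k _ do rewrite (leqW (ltn_ord k)).
    by rewrite sum1_card card_ord addn1.
  by rewrite -IH// ltnNge -ltnS gN addn0.
rewrite exchange_big; apply: eq_bigr => k _.
rewrite (component_gball TN) -(cardsDS (gball_sub (ltnW (ltn_ord k)))) -sum1_card.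
rewrite [RHS]big_mkcond [LHS]big_mkcond/=; apply: eq_bigr => v _.
by rewrite !inE; case: (v \in gball k); case: (v \in gball N).
Qed.

End Balls.

(** * One step of the exploration *)

Section Exploration.
Variables (R : realType) (n : nat) (q : R).
Local Notation V := (vertex n).
Local Notation graph := {set {set V}}.
Local Notation Ex := (subset_mean (vertex_pairs n) q).
Local Notation B := (fun k (E : graph) => gball (adj E) (vertex1 n) k).
Local Notation S := (fun k (E : graph) => gsphere (adj E) (vertex1 n) k).

(** Measurability with respect to the first [k] steps of the exploration. Conditional expectations
    given these steps are expressed by testing against adapted functions. *)
Definition adapted (k : nat) (G : graph -> R) : Prop :=
  forall E E', (forall j, (j <= k)%N -> B j E = B j E') -> G E = G E'.

Definition cross_edges (X Y : {set V}) : graph :=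
  [set [set s; w] | s in X, w in Y].

Lemma set2_disjoint_inj (X Y : {set V}) s w t y : [disjoint X & Y] ->
  s \in X -> w \in Y -> t \in X -> y \in Y ->
  [set s; w] = [set t; y] -> s = t /\ w = y.
Proof.
move=> XY sX wY tX yY st; split.
  have : s \in [set t; y] by rewrite -st set21.
  rewrite !inE => /orP[/eqP //|/eqP sy].
  by move/disjointFr: XY => /(_ _ sX); rewrite sy yY.
have : w \in [set t; y] by rewrite -st set22.
rewrite !inE => /orP[/eqP wt|/eqP //].
by move/disjointFr: XY => /(_ _ tX); rewrite -wt wY.
Qed.

Lemma card_cross_edges (X Y : {set V}) : [disjoint X & Y] ->
  #|cross_edges X Y| = (#|X| * #|Y|)%N.
Proof.
move=> XY; rewrite /cross_edges curry_imset2X card_in_imset ?cardsX//.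
move=> [s w] [t y]; rewrite !inE /= => /andP[sX wY] /andP[tX yY] st.
by have [-> ->] := set2_disjoint_inj XY sX wY tX yY st.
Qed.

Lemma cross_edges_pairs (X Y : {set V}) : [disjoint X & Y] ->
  cross_edges X Y \subset vertex_pairs n.
Proof.
move=> XY; apply/subsetP => f /imset2P[s w sX wY ->]; rewrite inE cards2.
suff -> : s != w by [].
by apply: contraTneq wY => <-; rewrite (disjointFr XY).
Qed.

(* The balls up to radius k are not affected by the edges between the sphere of
   radius k and the vertices outside the ball. *)
Lemma gball_agree k (E E' : graph) (Y : {set V}) : [disjoint B k E & Y] ->
    E :\: cross_edges (S k E) Y = E' :\: cross_edges (S k E) Y ->
  forall j, (j <= k)%N -> B j E = B j E'.
Proof.
move=> BY EE'; elim=> [//|j IH] jk.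
rewrite /= -(IH (ltnW jk)); congr (_ :|: _); apply/setP => v; rewrite !inE.
apply: eq_existsb => u.
case: (boolP (u \in B j E)) => //= uj; rewrite /adj.
have uC : [set u; v] \notin cross_edges (S k E) Y.
  apply/imset2P => -[s w sS wY uv].
  have : u \in [set s; w] by rewrite -uv set21.
  rewrite !inE => /orP[/eqP us|/eqP uw].
    by move: sS; rewrite -us; apply/negP; apply: gball_notin_gsphere jk uj.
  have uk : u \in B k E by exact: subsetP (gball_sub _ _ (ltnW jk)) _ uj.
  by move/disjointFr: BY => /(_ _ uk); rewrite uw wY.
by move/setP: EE' => /(_ [set u; v]); rewrite !in_setD uC.
Qed.

Lemma gsphere_agree k (E E' : graph) :
  (forall j, (j <= k)%N -> B j E = B j E') -> S k E = S k E'.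
Proof. by case: k => // k h; rewrite /gsphere (h k)// (h k.+1). Qed.

(** Once the ball and the sphere of radius [k] are fixed, the event on the next ball becomes the
    avoidance of a fixed set of edges, as [subset_mean_avoid] requires. *)
Lemma avoid_gballS k (E : graph) (Y : {set V}) :
  [disjoint B k.+1 E & Y] =
  [disjoint B k E & Y] && [disjoint cross_edges (S k E) Y & E].
Proof.
have [BY|BY] := boolP [disjoint B k E & Y]; last first.
  by apply/negbTE; apply: contra BY; apply: disjointWl; apply: gball_sub.
apply/idP/idP => [BY1|CE].
  rewrite disjoint_subset; apply/subsetP => f /imset2P[s w sS wY ->].
  have wk : w \notin B k E by rewrite (disjointFl BY).
  have : w \notin B k.+1 E by rewrite (disjointFl BY1).
  by rewrite notin_gballS// => /forall_inP/(_ _ sS).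
rewrite disjoint_sym disjoint_subset; apply/subsetP => w wY.
have wk : w \notin B k E by rewrite (disjointFl BY).
rewrite inE notin_gballS//; apply/forall_inP => s sS; rewrite /adj.
have : [set s; w] \in cross_edges (S k E) Y by apply: imset2_f.
by move/(disjointFr CE) => ->.
Qed.

(** Condition on the values [b], [s] of the ball and the sphere. The [#|s| * #|Y|] pairs between [s]
    and [Y] have not yet been examined by the exploration, so all of them are absent with
    probability [(1 - q) ^+ (#|s| * #|Y|)]. *)
Lemma mean_avoid_step k (Y : {set V}) G : adapted k G ->
  Ex (fun E => G E * [disjoint B k.+1 E & Y]%:R) =
  Ex (fun E => G E * [disjoint B k E & Y]%:R *
               ((1 - q) ^+ #|S k E|) ^+ #|Y|).
Proof.
move=> aG.
have split X : Ex X = \sum_(b : {set V} * {set V})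
    Ex (fun E => X E * ((B k E, S k E) == b)%:R).
  rewrite -subset_mean_sum; apply: eq_subset_mean => E.
  rewrite -mulr_sumr (bigD1 (B k E, S k E))//= eqxx big1 ?addr0 ?mulr1//.
  by move=> b /negPf; rewrite eq_sym => ->.
rewrite split [RHS]split; apply: eq_bigr => -[b s] _.
have [bY|bY] := boolP [disjoint b & Y]; last first.
  apply: eq_subset_mean => E; rewrite avoid_gballS.
  by case: eqP => [[-> ->]|]; rewrite ?mulr0// (negPf bY) /= !(mulr0, mul0r).
have [sb|sb] := boolP (s \subset b); last first.
  apply: eq_subset_mean => E; case: eqP => [[h1 h2]|]; rewrite ?mulr0//.
  by move: sb; rewrite -h1 -h2 gsphere_sub_gball.
have sY : [disjoint s & Y] by apply: disjointWl bY.
pose H E := G E * ((B k E, S k E) == (b, s))%:R.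
transitivity (Ex (fun E => H E * [disjoint cross_edges s Y & E]%:R)).
  apply: eq_subset_mean => E; rewrite /H avoid_gballS.
  by case: eqP => [[-> ->]|]; rewrite ?mulr0 ?mul0r// bY /= mulr1 mulrAC mulr1.
rewrite subset_mean_avoid ?cross_edges_pairs// ?card_cross_edges//.
  rewrite -subset_meanZ; apply: eq_subset_mean => E; rewrite /H.
  by case: eqP => [[-> ->]|]; rewrite ?mulr0// bY exprM !mulr1 mulrC.
(* Changing cross edges preserves the whole history up to radius [k], and with it the event that the
   ball and the sphere are [b] and [s]. The implication from one graph suffices, by symmetry. *)
have key E E' : E :\: cross_edges s Y = E' :\: cross_edges s Y ->
    (B k E, S k E) = (b, s) -> H E = H E'.
  move=> EE' [hb hs].
  have h : forall j, (j <= k)%N -> B j E = B j E'.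
    by apply: gball_agree (Y) _ _; rewrite ?hb ?hs.
  by rewrite /H (aG E E')// (h k)// (gsphere_agree h).
move=> E E' EE'.
have [h|h] := eqVneq (B k E, S k E) (b, s); first exact: key.
have [h'|h'] := eqVneq (B k E', S k E') (b, s); first by apply/esym/key.
by rewrite /H (negPf h) (negPf h') !mulr0.
Qed.

(** * Conditional moments of one exploration step *)

Definition uncount k (E : graph) : R := #|~: B k E|%:R.
Definition scount k (E : graph) : R := #|S k E|%:R.
Definition bcount k (E : graph) : R := #|B k E|%:R.
(** The conditional probability, given the first [k] balls, that a vertex outside them also stays
    outside the next ball. *)
Definition miss k (E : graph) : R := (1 - q) ^+ #|S k E|.

Lemma uncountE k E :
  uncount k E = \sum_(v : V) [disjoint B k E & [set v]]%:R.
Proof.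
rewrite /uncount -sum1_card natr_sum big_mkcond; apply: eq_bigr => v _.
by rewrite inE disjoint_sym disjoints1; case: (_ \in _).
Qed.

Lemma uncount_sqrE k E :
  uncount k E ^+ 2 = \sum_(v : V) \sum_(w : V) [disjoint B k E & [set v; w]]%:R.
Proof.
rewrite expr2 !uncountE mulr_suml; apply: eq_bigr => v _.
rewrite mulr_sumr; apply: eq_bigr => w _.
by rewrite -natrM mulnb -!setI_eq0 setIUr setU_eq0.
Qed.

Lemma mean_uncountS k G : adapted k G ->
  Ex (fun E => G E * uncount k.+1 E) = Ex (fun E => G E * (uncount k E * miss k E)).
Proof.
move=> aG.
transitivity (\sum_(v : V) Ex (fun E => G E * [disjoint B k.+1 E & [set v]]%:R)).
  rewrite -subset_mean_sum; apply: eq_subset_mean => E.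
  by rewrite uncountE mulr_sumr.
under eq_bigr => v _ do rewrite mean_avoid_step// cards1.
rewrite -subset_mean_sum; apply: eq_subset_mean => E.
by rewrite -mulr_suml uncountE -mulr_sumr expr1 -mulrA.
Qed.

(** The second moment of a binomial variable, from [mean_avoid_step] with [Y = [set v; w]]: the
    diagonal pairs contribute [miss] and the others [miss ^+ 2]. *)
Lemma mean_uncountS_sqr k G : adapted k G ->
  Ex (fun E => G E * uncount k.+1 E ^+ 2) =
  Ex (fun E => G E * (uncount k E ^+ 2 * miss k E ^+ 2 +
                      uncount k E * (miss k E * (1 - miss k E)))).
Proof.
move=> aG.
transitivity (\sum_(v : V) \sum_(w : V)
    Ex (fun E => G E * [disjoint B k.+1 E & [set v; w]]%:R)).
  under eq_bigr => v _ do rewrite -subset_mean_sum.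
  rewrite -subset_mean_sum; apply: eq_subset_mean => E.
  by rewrite uncount_sqrE mulr_sumr; apply: eq_bigr => v _; rewrite mulr_sumr.
under eq_bigr => v _ do (under eq_bigr => w _ do rewrite mean_avoid_step//;
  rewrite -subset_mean_sum).
rewrite -subset_mean_sum; apply: eq_subset_mean => E.
under eq_bigr => v _ do (under eq_bigr => w _ do rewrite -mulrA; rewrite -mulr_sumr).
rewrite -mulr_sumr; congr (_ * _).
rewrite uncount_sqrE {1}uncountE !mulr_suml -big_split; apply: eq_bigr => v _ /=.
rewrite (bigD1 v)//= [in RHS](bigD1 v)//= setUid cards1 -/(miss k E).
rewrite [X in _ + X = _](_ : _ = \sum_(w | w != v)
    [disjoint B k E & [set v; w]]%:R * miss k E ^+ 2).
  by rewrite -mulr_suml; ring.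
by apply: eq_bigr => w wv; rewrite cards2 eq_sym wv.
Qed.

Lemma adapted_gball k j (F : {set V} -> R) : (j <= k)%N ->
  adapted k (fun E => F (B j E)).
Proof. by move=> jk E E' h; rewrite (h j jk). Qed.

Lemma adapted_gsphere k j (F : {set V} -> R) : (j <= k)%N ->
  adapted k (fun E => F (S j E)).
Proof.
move=> jk E E' h; congr F; apply: gsphere_agree => i ij.
exact: h (leq_trans ij jk).
Qed.

Lemma adapted_comp k (f : R -> R) G : adapted k G -> adapted k (fun E => f (G E)).
Proof. by move=> aG E E' h; rewrite (aG E E'). Qed.

Lemma adapted_op k (op : R -> R -> R) F G : adapted k F -> adapted k G ->
  adapted k (fun E => op (F E) (G E)).
Proof. by move=> aF aG E E' h; rewrite (aF E E')// (aG E E'). Qed.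

Lemma adapted_uncount k j : (j <= k)%N -> adapted k (uncount j).
Proof. exact: (adapted_gball (fun X => #|~: X|%:R)). Qed.

Lemma adapted_bcount k j : (j <= k)%N -> adapted k (bcount j).
Proof. exact: (adapted_gball (fun X => #|X|%:R)). Qed.

Lemma adapted_scount k j : (j <= k)%N -> adapted k (scount j).
Proof. exact: (adapted_gsphere (fun X => #|X|%:R)). Qed.

Lemma adapted_miss k j : (j <= k)%N -> adapted k (miss j).
Proof. exact: (adapted_gsphere (fun X => (1 - q) ^+ #|X|)). Qed.

(** The conditional variance of a binomial variable. Expand the square and apply the two moment
    identities, the conditional mean [m] being itself adapted. *)
Lemma var_uncountS k :
  Ex (fun E => (uncount k.+1 E - uncount k E * miss k E) ^+ 2) =
  Ex (fun E => uncount k E * (miss k E * (1 - miss k E))).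
Proof.
pose m E := uncount k E * miss k E.
have am : adapted k m.
  by apply: (adapted_op *%R); [exact: adapted_uncount|exact: adapted_miss].
transitivity (Ex (fun E => 1 * uncount k.+1 E ^+ 2) -
    2 * Ex (fun E => m E * uncount k.+1 E) + Ex (fun E => m E ^+ 2)).
  rewrite -subset_meanZ -subset_meanB -subset_meanD; apply: eq_subset_mean => E.
  by rewrite -/(m E); ring.
rewrite mean_uncountS_sqr// mean_uncountS//.
rewrite -subset_meanZ -subset_meanB -subset_meanD; apply: eq_subset_mean => E.
by rewrite /m; ring.
Qed.

Lemma bcountE k E : bcount k E = #|V|%:R - uncount k E.
Proof. by rewrite /bcount /uncount -(cardsC (B k E)) natrD addrK. Qed.

Lemma scountS k E : scount k.+1 E = uncount k E - uncount k.+1 E.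
Proof.
have h := @gball_sub _ (adj E) (vertex1 n) _ _ (leqnSn k).
rewrite /scount /gsphere cardsDS// natrB ?subset_leq_card//.
by rewrite -/(bcount k.+1 E) -/(bcount k E) !bcountE; ring.
Qed.

Lemma scount0 E : scount 0 E = 1. Proof. by rewrite /scount cards1. Qed.

Lemma bcount0 E : bcount 0 E = 1. Proof. by rewrite /bcount cards1. Qed.

Lemma bcountS k E : bcount k.+1 E = bcount k E + scount k.+1 E.
Proof. by rewrite scountS !bcountE; ring. Qed.

Lemma uncount_ge0 k E : 0 <= uncount k E. Proof. exact: ler0n. Qed.

Lemma scount_ge0 k E : 0 <= scount k E. Proof. exact: ler0n. Qed.

Lemma bcount_ge0 k E : 0 <= bcount k E. Proof. exact: ler0n. Qed.

Lemma uncount_le k E : uncount k E <= #|V|%:R.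
Proof. by rewrite ler_nat max_card. Qed.

Lemma scount_le k E : scount k E <= #|V|%:R.
Proof. by rewrite ler_nat max_card. Qed.

Lemma uncount_anti i j E : (i <= j)%N -> uncount j E <= uncount i E.
Proof.
by move=> ij; rewrite ler_nat subset_leq_card// setCS gball_sub.
Qed.

Lemma dist_sumE N E : (#|V| <= N)%N ->
  (dist_sum E)%:R = \sum_(k < N) (uncount k E - uncount N E).
Proof.
move=> VN; rewrite /dist_sum (sum_gdist _ _ VN) natr_sum; apply: eq_bigr => k _.
rewrite natrB ?subset_leq_card ?gball_sub 1?ltnW//.
by rewrite -/(bcount N E) -/(bcount k E) !bcountE; ring.
Qed.

End Exploration.

(** * Moments of the spheres *)

Section PowerBounds.
Variables (R : realType) (q : R).
Hypothesis q01 : 0 <= q <= 1.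

Lemma exprB_ge (m : nat) : 1 - q * m%:R <= (1 - q) ^+ m.
Proof.
case/andP: q01 => q0 q1; elim: m => [|m IH]; first by rewrite mulr0 subr0 expr0.
rewrite exprS; apply: le_trans (_ : _ <= (1 - q) * (1 - q * m%:R)) _.
  by have := ler0n R m; rewrite -natr1; nra.
by rewrite ler_wpM2l// subr_ge0.
Qed.

Lemma exprB_le (m : nat) :
  (1 - q) ^+ m <= 1 - q * m%:R + q ^+ 2 * m%:R ^+ 2 / 2.
Proof.
case/andP: q01 => q0 q1; elim: m => [|m IH].
  by rewrite expr0 mulr0 subr0 expr0n mulr0 mul0r addr0.
rewrite exprS; apply: le_trans
  (_ : _ <= (1 - q) * (1 - q * m%:R + q ^+ 2 * m%:R ^+ 2 / 2)) _.
  by rewrite ler_wpM2l// subr_ge0.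
rewrite -natr1 -subr_ge0.
rewrite (_ : _ - _ = q ^+ 2 / 2 + q * (q ^+ 2 * m%:R ^+ 2 / 2)); last by field.
by rewrite addr_ge0// ?mulr_ge0// ?sqr_ge0.
Qed.

Lemma exprB_expR (m : nat) : (1 - q) ^+ m <= expR (- (q * m%:R)).
Proof.
case/andP: q01 => q0 q1.
rewrite -mulNr mulrC expRM_natl lerXn2r// ?nnegrE ?subr_ge0 ?expR_ge0//.
exact: expR_ge1Dx.
Qed.

(** Telescope the difference of two [m]-th powers: all factors lie in [0, 1], and each replacement
    of [expR (- q)] by [1 - q] costs at most [q ^+ 2]. *)
Lemma expR_exprB (m : nat) : expR (- (q * m%:R)) - (1 - q) ^+ m <= m%:R * q ^+ 2.
Proof.
case/andP: q01 => q0 q1; rewrite -mulNr mulrC expRM_natl.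
have e1 : expR (- q) <= 1 by rewrite -expR0 ler_expR oppr_le0.
have ge : 1 - q <= expR (- q) by apply: expR_ge1Dx.
have le : expR (- q) - (1 - q) <= q ^+ 2.
  have : 1 + q <= expR q by apply: expR_ge1Dx.
  have : expR q * expR (- q) = 1 by rewrite -expRD subrr expR0.
  by have := expR_gt0 (- q); nra.
elim: m => [|m IH]; first by rewrite !expr0 subrr mul0r.
rewrite (exprS (expR _)) (exprS (1 - q)) -natr1 [leRHS]mulrDl mul1r.
rewrite (_ : _ - _ = expR (- q) * (expR (- q) ^+ m - (1 - q) ^+ m) +
  (expR (- q) - (1 - q)) * (1 - q) ^+ m); last by ring.
have p0 : 0 <= (1 - q) ^+ m by rewrite exprn_ge0 ?subr_ge0.
have p1 : (1 - q) ^+ m <= 1 by rewrite exprn_ile1// ?subr_ge0//; lra.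
have pe : (1 - q) ^+ m <= expR (- q) ^+ m.
  by rewrite lerXn2r// nnegrE ?subr_ge0 ?expR_ge0.
by apply: lerD; [have := expR_gt0 (- q); nra|nra].
Qed.

End PowerBounds.

Section Moments.
Variables (R : realType) (n : nat) (q : R).
Hypothesis q01 : 0 <= q <= 1.
Local Notation V := (vertex n).
Local Notation graph := {set {set V}}.
Local Notation Ex := (subset_mean (vertex_pairs n) q).
Local Notation u := (@uncount R n).
Local Notation s := (@scount R n).
Local Notation b := (@bcount R n).
Local Notation m := (@miss R n q).
Local Notation N := (#|V|%:R).
Local Notation D := (N * q).

Lemma miss_ge0 k E : 0 <= m k E.
Proof. by case/andP: q01 => *; rewrite exprn_ge0 ?subr_ge0. Qed.

Lemma miss_le1 k E : m k E <= 1.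
Proof. by case/andP: q01 => *; rewrite exprn_ile1 ?subr_ge0//; lra. Qed.

Lemma miss_ge k E : 1 - q * s k E <= m k E. Proof. exact: exprB_ge. Qed.

Lemma miss_le k E : m k E <= 1 - q * s k E + q ^+ 2 * s k E ^+ 2 / 2.
Proof. exact: exprB_le. Qed.

Lemma miss_le_expR k E : m k E <= expR (- (q * s k E)).
Proof. exact: exprB_expR. Qed.

Lemma expR_miss_le k E : expR (- (q * s k E)) - m k E <= s k E * q ^+ 2.
Proof. exact: expR_exprB. Qed.

(** Union bound for the conditional mean of the next sphere. *)
Lemma hit_le k E : u k E * (1 - m k E) <= D * s k E.
Proof.
rewrite -mulrA; apply: ler_pM; rewrite ?uncount_ge0 ?uncount_le//.
  by rewrite subr_ge0 miss_le1.
by have := miss_ge k E; lra.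
Qed.

Lemma var_uncountS_le k :
  Ex (fun E => (u k.+1 E - u k E * m k E) ^+ 2) <= D * Ex (s k).
Proof.
rewrite var_uncountS -subset_meanZ; apply: le_subset_mean => // E.
apply: le_trans (hit_le k E); rewrite ler_wpM2l ?uncount_ge0//.
by have := miss_ge0 k E; have := miss_le1 k E; nra.
Qed.

Lemma mean_scountS k G : adapted k G ->
  Ex (fun E => G E * s k.+1 E) = Ex (fun E => G E * (u k E * (1 - m k E))).
Proof.
move=> aG.
transitivity (Ex (fun E => G E * u k E) - Ex (fun E => G E * u k.+1 E)).
  by rewrite -subset_meanB; apply: eq_subset_mean => E; rewrite scountS mulrBr.
rewrite mean_uncountS// -subset_meanB; apply: eq_subset_mean => E; ring.
Qed.

Lemma mean_scountS_le k G : adapted k G -> (forall E, 0 <= G E) ->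
  Ex (fun E => G E * s k.+1 E) <= D * Ex (fun E => G E * s k E).
Proof.
move=> aG G0; rewrite mean_scountS// -subset_meanZ.
apply: le_subset_mean => // E; rewrite [leRHS]mulrCA; apply: ler_wpM2l => //.
exact: hit_le.
Qed.

(** The second moment is the mean of the squared conditional mean plus the mean conditional
    variance; [hit_le] bounds both. *)
Lemma mean_scountS_sqr_le k :
  Ex (fun E => s k.+1 E ^+ 2) <= D ^+ 2 * Ex (fun E => s k E ^+ 2) + D * Ex (s k).
Proof.
have -> : Ex (fun E => s k.+1 E ^+ 2) =
    Ex (fun E => (u k E * (1 - m k E)) ^+ 2) +
    Ex (fun E => u k E * (m k E * (1 - m k E))).
  transitivity (Ex (fun E => 1 * u k.+1 E ^+ 2) -
      2 * Ex (fun E => u k E * u k.+1 E) + Ex (fun E => u k E ^+ 2)).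
    rewrite -subset_meanZ -subset_meanB -subset_meanD; apply: eq_subset_mean => E.
    by rewrite scountS; ring.
  rewrite mean_uncountS_sqr// mean_uncountS; last exact: adapted_uncount.
  rewrite -subset_meanZ -subset_meanB -!subset_meanD; apply: eq_subset_mean => E.
  ring.
rewrite -!subset_meanZ; apply: lerD; apply: le_subset_mean => // E.
  rewrite -exprMn lerXn2r ?nnegrE ?hit_le//.
    by rewrite mulr_ge0 ?uncount_ge0// subr_ge0 miss_le1.
  by case/andP: q01 => *; rewrite !mulr_ge0 ?scount_ge0.
apply: le_trans (hit_le k E); rewrite ler_wpM2l ?uncount_ge0//.
by have := miss_ge0 k E; have := miss_le1 k E; nra.
Qed.

Lemma mean_scount_le k : Ex (s k) <= D ^+ k.
Proof.
have D0 : 0 <= D by case/andP: q01 => *; rewrite mulr_ge0.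
elim: k => [|k IH].
  by rewrite (eq_subset_mean _ _ (@scount0 R n)) subset_mean_cst.
have := @mean_scountS_le k (fun=> 1) (fun _ _ _ => erefl) (fun=> ler01).
under eq_subset_mean => E do rewrite mul1r.
under [in X in _ <= X]eq_subset_mean => E do rewrite mul1r.
by move=> h; rewrite exprS (le_trans h)// ler_wpM2l.
Qed.

Hypothesis D2 : 2 <= D.

Lemma D_ge0 : 0 <= D. Proof. by apply: le_trans D2. Qed.

Lemma D_exp_ge1 k : 1 <= D ^+ k.
Proof. by apply: exprn_ege1; apply: le_trans D2; lra. Qed.

(** The correction [- D ^+ k] closes the induction: with [t = D ^+ k], the step yields
    [- D ^+ 2 * t + D * t], which is at most [- D * t] since [2 <= D]. *)
Lemma mean_scount_sqr_le k : Ex (fun E => s k E ^+ 2) <= 2 * D ^+ k ^+ 2 - D ^+ k.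
Proof.
elim: k => [|k IH].
  under eq_subset_mean => E do rewrite scount0.
  by rewrite subset_mean_cst expr0; lra.
have h := mean_scountS_sqr_le k; have h1 := mean_scount_le k.
apply: le_trans h _; rewrite (exprS _ k); have := D_exp_ge1 k.
move: D2 h1 IH; set d := D; set t := d ^+ k => d2 h1 IH t1.
clearbody t; clearbody d; have := ler_wpM2l (sqr_ge0 d) IH.
have d0 : 0 <= d by lra.
have := ler_wpM2l d0 h1.
have : 0 <= (d - 2) * (d * t) by rewrite !mulr_ge0//; lra.
by move=> *; nra.
Qed.

Lemma mean_bcount_le k : Ex (b k) <= 2 * D ^+ k.
Proof.
elim: k => [|k IH].
  under eq_subset_mean => E do rewrite bcount0.
  by rewrite subset_mean_cst expr0; lra.
under eq_subset_mean => E do rewrite bcountS.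
rewrite subset_meanD; have h1 := mean_scount_le k.+1.
have := D_exp_ge1 k; move: D2 IH h1; rewrite (exprS _ k).
by set d := D; set t := d ^+ k => d2; nra.
Qed.

Lemma sum_mean_bcount_le k : \sum_(j < k.+1) Ex (b j) <= 4 * D ^+ k.
Proof.
elim: k => [|k IH]; rewrite big_ord_recr/=.
  by rewrite big_ord0 add0r; have := mean_bcount_le 0; rewrite expr0; lra.
have h1 := mean_bcount_le k.+1.
have := D_exp_ge1 k; move: D2 IH h1; rewrite (exprS _ k).
by set d := D; set t := d ^+ k => d2; nra.
Qed.

(** Split off the newest sphere from the ball. The old ball is adapted, so its product with the new
    sphere gains only a factor [D], which is at most [D ^+ 2 / 2]; the squared sphere accounts for
    the other half. *)
Lemma mean_bcount_scount_le k : Ex (fun E => b k E * s k E) <= 4 * D ^+ k ^+ 2.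
Proof.
elim: k => [|k IH].
  under eq_subset_mean => E do rewrite bcount0 scount0.
  by rewrite subset_mean_cst expr0; lra.
have -> : Ex (fun E => b k.+1 E * s k.+1 E) =
    Ex (fun E => b k E * s k.+1 E) + Ex (fun E => s k.+1 E ^+ 2).
  by rewrite -subset_meanD; apply: eq_subset_mean => E; rewrite bcountS; ring.
have h1 := mean_scountS_le (adapted_bcount _ (leqnn k)) (@bcount_ge0 R n k).
have h2 := mean_scount_sqr_le k.+1; have := D_exp_ge1 k.
move: D2 IH h1 h2; rewrite (exprS _ k).
by set d := D; set t := d ^+ k => d2 IH h1 h2 t1; nra.
Qed.

(** Depletion error of the mean: [q * b * s] comes from the vertices already in the ball, and
    [N * q ^+ 2 / 2 * s ^+ 2] from the second-order term of [miss]. *)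
Lemma mean_bias_le k :
  Ex (fun E => `|D * s k E - u k E * (1 - m k E)|) <= 3 * D ^+ k.+1 ^+ 2 / N.
Proof.
have N0 : 0 < N :> R by rewrite ltr0n; apply/card_gt0P; exists (vertex1 n).
apply: le_trans (_ : _ <= q * Ex (fun E => b k E * s k E) +
    N * q ^+ 2 / 2 * Ex (fun E => s k E ^+ 2)) _.
  rewrite -!subset_meanZ -subset_meanD; apply: le_subset_mean => // E.
  rewrite ger0_norm ?subr_ge0 ?hit_le//.
  have h1 := miss_le k E; have h2 := uncount_ge0 R k E; have h3 := uncount_le R k E.
  rewrite bcountE; move: h1 h2 h3.
  set uu := u k E; set ss := s k E; set mm := m k E => h1 h2 h3.
  have : uu * (q * ss - q ^+ 2 * ss ^+ 2 / 2) <= uu * (1 - mm).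
    by rewrite ler_wpM2l//; lra.
  have : uu * (q ^+ 2 * ss ^+ 2) <= N * (q ^+ 2 * ss ^+ 2).
    by rewrite ler_wpM2r// mulr_ge0 ?sqr_ge0.
  by move=> *; lra.
have h1 := mean_bcount_scount_le k; have h2 := mean_scount_sqr_le k.
have t1 := D_exp_ge1 k.
rewrite ler_pdivlMr// (exprS _ k); move: D2 h1 h2 t1.
set d := D; set t := d ^+ k; set y := Ex _; set z := Ex _ => d2 h1 h2 t1.
have -> : (q * y + N * q ^+ 2 / 2 * z) * N = d * y + d ^+ 2 / 2 * z.
  by rewrite /d; ring.
clearbody t; clearbody d.
have : d * y <= d * (4 * t ^+ 2) by rewrite ler_wpM2l//; lra.
have : d ^+ 2 / 2 * z <= d ^+ 2 / 2 * (2 * t ^+ 2).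
  by rewrite ler_wpM2l ?mulr_ge0 ?sqr_ge0//; nra.
have : 0 <= (d - 2) * (d * t ^+ 2) by rewrite !mulr_ge0 ?sqr_ge0//; lra.
by move=> *; nra.
Qed.

(** The deviation at [k.+1] is noise plus bias plus [D] times the deviation at [k]. The noise is at
    most [w ^+ k.+1] in L^1 by its variance, and the slack [- 2 * w ^+ k] absorbs it since [2 <= w];
    the bias terms at least double relative to the factor [D], whence the constant 6 from 3. *)
Lemma mean_scount_dev_le (w : R) k : 2 <= w -> w ^+ 2 = D ->
  w * Ex (fun E => `|s k E - D ^+ k|) <=
  2 * w ^+ k ^+ 2 - 2 * w ^+ k + 6 * w * (D ^+ k ^+ 2 / N).
Proof.
move=> w2 wD.
have N0 : 0 < N :> R by rewrite ltr0n; apply/card_gt0P; exists (vertex1 n).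
elim: k => [|k IH].
  under eq_subset_mean => E do rewrite scount0 expr0 subrr normr0.
  rewrite subset_mean_cst !expr0 mulr0 expr1n mulr1 subrr add0r.
  by rewrite !mulr_ge0// ?invr_ge0; lra.
have noise : Ex (fun E => `|u k.+1 E - u k E * m k E|) <= w ^+ k.+1.
  apply: subset_mean_norm_le => //; first by rewrite exprn_gt0//; lra.
  apply: le_trans (var_uncountS_le k) _.
  rewrite -exprM mulnC exprM wD exprS ler_wpM2l ?mean_scount_le ?D_ge0//.
have step : Ex (fun E => `|s k.+1 E - D ^+ k.+1|) <=
    Ex (fun E => `|u k.+1 E - u k E * m k E|) +
    Ex (fun E => `|D * s k E - u k E * (1 - m k E)|) +
    D * Ex (fun E => `|s k E - D ^+ k|).
  rewrite -subset_meanZ -!subset_meanD; apply: le_subset_mean => // E.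
  have -> : s k.+1 E - D ^+ k.+1 = - (u k.+1 E - u k E * m k E)
      - (D * s k E - u k E * (1 - m k E)) + D * (s k E - D ^+ k).
    by rewrite scountS exprS; ring.
  apply: le_trans (ler_normD _ _) _; rewrite normrM [`|D|]ger0_norm ?D_ge0//.
  by rewrite lerD2r; apply: le_trans (ler_normB _ _) _; rewrite normrN.
have bias := mean_bias_le k.
have w0 : 0 <= w by lra.
apply: le_trans (ler_wpM2l w0 step) _.
rewrite !mulrDr.
have h1 := ler_wpM2l w0 noise; have h2 := ler_wpM2l w0 bias.
have D0 := D_ge0.
have h3 := ler_wpM2l D0 IH.
apply: le_trans (lerD (lerD h1 h2) _) _; first by rewrite mulrCA; exact: h3.
have p1 : 1 <= w ^+ k by apply: exprn_ege1; lra.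
have : 0 <= w * (D ^+ k.+1 ^+ 2 / N - 2 * (D * (D ^+ k ^+ 2 / N))).
  rewrite mulr_ge0// (_ : _ - _ = (D - 2) * (D * (D ^+ k ^+ 2 / N))).
    apply: mulr_ge0; first by rewrite subr_ge0.
    exact: mulr_ge0 D0 (divr_ge0 (sqr_ge0 _) (ltW N0)).
  by rewrite (exprS _ k); ring.
set X := D ^+ k.+1 ^+ 2 / N; set Y := D ^+ k ^+ 2 / N => XY.
rewrite -[3 * _ ^+ 2 / N]mulrA -/X -wD.
rewrite (exprS _ k); set t := w ^+ k.
have : 0 <= (w - 2) * w * t by rewrite !mulr_ge0// /t; lra.
move: XY; rewrite -wD => XY wt.
by nra.
Qed.

End Moments.

(** * The distance sum *)

Opaque uncount scount bcount miss.

(** * Elementary bounds on the exponential *)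

Section ExpBounds.
Variable R : realType.
Implicit Types a x y z : R.

Lemma expRN_le_inv x : 0 <= x -> expR (- x) * (1 + x) <= 1.
Proof.
move=> x0; have := expR_ge1Dx x; have := expR_gt0 (- x).
have : expR x * expR (- x) = 1 by rewrite -expRD subrr expR0.
by nra.
Qed.

(** The bound is uniform in [a], because [x * expR (- x) <= 1]. For [z <= 1/2] the right side is at
    least 1; for [z] in (1/2, 1] the slope [a * expR (- (a * z))] is at most 2; beyond 1 it is at
    most 1. *)
Lemma dist_expR_le a z : 0 <= a -> 0 <= z ->
  `|expR (- (a * z)) - expR (- a)| <= 2 * `|z - 1|.
Proof.
move=> a0 z0.
have e1 x : 0 <= x -> 0 < expR (- x) <= 1.
  by move=> x0; rewrite expR_gt0 -expR0 ler_expR oppr_le0.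
have eB x y : expR (- x) - expR (- (x + y)) <= expR (- x) * y.
  rewrite opprD expRD; have := expR_ge1Dx (- y); have := expR_gt0 (- x); nra.
have /andP[ea0 ea1] := e1 _ a0.
have /andP[ez0 ez1] := e1 _ (mulr_ge0 a0 z0).
have [z1|z1] := lerP z 1.
  have le : expR (- a) <= expR (- (a * z)) by rewrite ler_expR lerN2; nra.
  rewrite ger0_norm ?subr_ge0//.
  have [z2|z2] := lerP z (1 / 2); first by lra.
  have := eB (a * z) (a * (1 - z)).
  rewrite (_ : a * z + a * (1 - z) = a); last by ring.
  have := expRN_le_inv (mulr_ge0 a0 z0).
  have : 0 <= expR (- (a * z)) * (a * (z - 1 / 2)).
    by rewrite !mulr_ge0//; lra.
  set p := expR (- (a * z)) => h1 h2 h3.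
  have h4 : p * a <= 2 by nra.
  have : (p * a) * (1 - z) <= 2 * (1 - z) by rewrite ler_wpM2r//; lra.
  by lra.
have le : expR (- (a * z)) <= expR (- a) by rewrite ler_expR lerN2; nra.
rewrite ler0_norm ?subr_le0//.
have := eB a (a * (z - 1)).
rewrite (_ : a + a * (z - 1) = a * z); last by ring.
have := expRN_le_inv a0; set p := expR (- a) => h1 h2.
have : (p * a) * (z - 1) <= 1 * (z - 1) by rewrite ler_wpM2r//; nra.
by lra.
Qed.

Lemma expRN_le_half x : 0 <= x -> x <= 1 -> expR (- x) <= 1 - x / 2.
Proof.
move=> x0 x1; have := expRN_le_inv x0; have := expR_gt0 (- x).
set p := expR (- x) => p0 h; rewrite -(ler_pM2r (_ : 0 < 1 + x)); last lra.
by apply: le_trans h _; nra.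
Qed.

End ExpBounds.

Section DistanceSum.
Variables (R : realType) (n : nat) (q w lam sig eps : R) (K : nat).
Local Notation V := (vertex n).
Local Notation graph := {set {set V}}.
Local Notation Ex := (subset_mean (vertex_pairs n) q).
Local Notation u := (@uncount R n).
Local Notation s := (@scount R n).
Local Notation b := (@bcount R n).
Local Notation m := (@miss R n q).
Local Notation N := (#|V|%:R).
Local Notation D := (N * q).
Hypotheses (q01 : 0 <= q <= 1) (w2 : 2 <= w) (wD : w ^+ 2 = D).
Local Notation zeta := (2 / w + 6 * (D ^+ K / N)).

Let N0 : 0 < N :> R.
Proof. by rewrite ltr0n; apply/card_gt0P; exists (vertex1 n). Qed.

Let D2 : 2 <= D.
Proof. by rewrite -wD; apply: le_trans w2 _; apply: ler_eXnr => //; move: w2; lra. Qed.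

Let DK0 : 0 < D ^+ K. Proof. exact: lt_le_trans ltr01 (D_exp_ge1 D2 K). Qed.

(** [zeta] bounds the relative L^1 error of the sphere of radius [K], the last one before the
    critical radius d* = [K.+1]. *)
Lemma mean_scount_reldev_le :
  Ex (fun E => `|s K E - D ^+ K|) <= zeta * D ^+ K.
Proof.
have w0 : 0 < w by move: w2; lra.
rewrite -(ler_pM2l w0); apply: le_trans (mean_scount_dev_le q01 D2 K w2 wD) _.
rewrite -exprM mulnC exprM wD.
have -> : w * (zeta * D ^+ K) =
    2 * D ^+ K + 6 * w * (D ^+ K ^+ 2 / N).
  by field; rewrite !gt_eqF.
by rewrite lerD2r gerBl mulr_ge0// exprn_ge0// ltW.
Qed.

(** For the step to the critical radius, where [D ^+ K.+1] may exceed [N], the variance is bounded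
    by the number of vertices. *)
Lemma mean_noise_sqr_le k : Ex (fun E => (u k.+1 E - u k E * m k E) ^+ 2) <= N.
Proof.
rewrite var_uncountS -[leRHS](subset_mean_cst (vertex_pairs n) q).
apply: le_subset_mean => // E; apply: le_trans (uncount_le R k E).
have := miss_ge0 q01 k E; have := miss_le1 q01 k E; have := uncount_ge0 R k E.
set mm := m k E => h1 h2 h3; rewrite -[leRHS]mulr1 ler_wpM2l//; nra.
Qed.

Hypothesis lamE : lam = expR (- (D ^+ K.+1 / N)).

(** The four terms on the right are, in order: the binomial noise; the vertices in the ball of
    radius [K]; the replacement of [miss] by an exponential, at most [N * (N * q ^+ 2)]; and the
    fluctuation of the sphere, through [dist_expR_le] with [a = D ^+ K.+1 / N] and
    [z = s K E / D ^+ K]. *)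
Lemma mean_uncount_dev_le :
  Ex (fun E => `|u K.+1 E - lam * N|) <=
  Num.sqrt N + 2 * D ^+ K + D ^+ 2 + 2 * N * zeta.
Proof.
have /andP[q0 q1] := q01.
apply: le_trans (_ : _ <= Ex (fun E => `|u K.+1 E - u K E * m K E|) +
   Ex (b K) + Ex (fun=> D ^+ 2) +
   2 * N * ((D ^+ K)^-1 * Ex (fun E => `|s K E - D ^+ K|))) _; last first.
  apply: lerD; [apply: lerD; [apply: lerD|]|].
  - apply: subset_mean_norm_le; rewrite ?sqrtr_gt0// sqr_sqrtr ?ler0n//.
    exact: mean_noise_sqr_le.
  - exact: mean_bcount_le.
  - by rewrite subset_mean_cst.
  - rewrite ler_wpM2l ?mulr_ge0 ?ler0n//.
    by rewrite mulrC ler_pdivrMr//; exact: mean_scount_reldev_le.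
rewrite -!subset_meanZ -!subset_meanD; apply: le_subset_mean => // E.
have -> : u K.+1 E - lam * N = (u K.+1 E - u K E * m K E) - b K E * m K E
    + - (N * (expR (- (q * s K E)) - m K E)) + N * (expR (- (q * s K E)) - lam).
  by rewrite bcountE; ring.
have m0 := miss_ge0 q01 K E; have m1 := miss_le1 q01 K E.
have b0 := bcount_ge0 R K E; have s0 := scount_ge0 R K E.
apply: le_trans (ler_normD _ _) _; apply: lerD; last first.
  rewrite normrM normr_nat (mulrC 2) -mulrA ler_wpM2l ?ler0n//.
  have -> : (D ^+ K)^-1 * `|s K E - D ^+ K| = `|s K E / D ^+ K - 1|.
    rewrite -[X in X * `|_|]ger0_norm ?invr_ge0 1?ltW// -normrM.
    by congr `|_|; field; rewrite gt_eqF.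
  rewrite lamE (_ : q * s K E = (D ^+ K.+1 / N) * (s K E / D ^+ K)).
    by apply: dist_expR_le; rewrite divr_ge0// ?exprn_ge0 ?(D_ge0 D2)// ltW.
  by rewrite exprS; field; rewrite !gt_eqF.
apply: le_trans (ler_normD _ _) _; apply: lerD; last first.
  rewrite normrN normrM normr_nat ger0_norm; last first.
    by rewrite subr_ge0 miss_le_expR.
  rewrite exprMn expr2 -mulrA ler_wpM2l ?ler0n//.
  apply: le_trans (expR_miss_le q01 _ _) _.
  by rewrite ler_wpM2r ?sqr_ge0// scount_le.
apply: le_trans (ler_normB _ _) _; rewrite lerD2l ger0_norm ?mulr_ge0//.
by rewrite ler_piMr.
Qed.

Hypotheses (sig0 : 0 < sig) (sig1 : 8 * sig <= 1)
  (sigD : 16 * sig <= D ^+ K.+1 / N).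

(** Outside the first two bad events the sphere has at least [D ^+ K / 2] vertices and at least
    [N / 2] remain outside, so [miss] is at most [1 - 4 * sig] and the next sphere has conditional
    mean at least [2 * sig * N]. A sphere below [sig * N] then forces a large noise. *)
Lemma scount_lt_bad E : s K.+1 E < sig * N ->
  [|| D ^+ K / 2 <= `|s K E - D ^+ K|, N / 2 <= b K E |
      (sig * N) ^+ 2 <= (u K.+1 E - u K E * m K E) ^+ 2].
Proof.
move=> sd; case: lerP => //= h1; case: lerP => //= h2.
have [s0 s1 sD] := And3 sig0 sig1 sigD.
set y := u K.+1 E - _.
have [yle|yle] := lerP (sig * N) y.
  have sN : 0 <= sig * N by rewrite mulr_ge0// ltW.
  by rewrite lerXn2r ?nnegrE//; exact: le_trans yle.
exfalso; have /andP[q0 q1] := q01.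
have sK : D ^+ K / 2 <= s K E by move: h1; rewrite ltr_norml => /andP[]; lra.
have qs : 8 * sig <= q * s K E.
  apply: le_trans (_ : _ <= q * (D ^+ K / 2)) _; last by rewrite ler_wpM2l.
  have <- : (D ^+ K.+1 / N) / 2 = q * (D ^+ K / 2).
    by rewrite exprS; field; rewrite gt_eqF.
  by rewrite ler_pdivlMr//; lra.
have m1 : m K E <= 1 - 4 * sig.
  apply: le_trans (miss_le_expR q01 _ _) _.
  apply: le_trans (_ : _ <= expR (- (8 * sig))) _.
    by rewrite ler_expR lerN2.
  by apply: le_trans (expRN_le_half _ sig1) _; lra.
have : N / 2 * (4 * sig) <= u K E * (1 - m K E).
  apply: ler_pM; [by rewrite ltW// divr_gt0|lra| |lra].
  by move: h2; rewrite bcountE; lra.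
move: sd; rewrite scountS /y in yle *.
have : 0 < sig * N by rewrite mulr_gt0.
by move: yle; rewrite /y; nra.
Qed.

Lemma prob_scount_lt :
  Ex (fun E => (s K.+1 E < sig * N)%R%:R) <=
  2 * zeta + 4 * (D ^+ K / N) + 1 / (sig ^+ 2 * N).
Proof.
apply: le_trans (_ : _ <=
    Ex (fun E => (D ^+ K / 2 <= `|s K E - D ^+ K|)%R%:R) +
    Ex (fun E => (N / 2 <= b K E)%R%:R) +
    Ex (fun E => ((sig * N) ^+ 2 <= (u K.+1 E - u K E * m K E) ^+ 2)%R%:R)) _.
  rewrite -!subset_meanD; apply: le_subset_mean => // E.
  have [/scount_lt_bad|_] := ltrP (s K.+1 E) (sig * N); last by rewrite !addr_ge0.
  by rewrite -!natrD ler1n; do 3 case: (_ <= _)%R.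
have sN : 0 < sig * N by rewrite mulr_gt0.
apply: lerD; [apply: lerD|].
- have t0 : 0 < D ^+ K / 2 by rewrite divr_gt0.
  apply: le_trans (@subset_mean_markov _ _ (vertex_pairs n) _ q01
    (fun E => `|s K E - D ^+ K|) (fun E => D ^+ K / 2 <= `|s K E - D ^+ K|)
    _ t0 _ _) _ => //.
  rewrite ler_pdivrMr//; apply: le_trans mean_scount_reldev_le _.
  by rewrite le_eqVlt; apply/orP; left; apply/eqP; field; rewrite !gt_eqF//; move: w2; lra.
- have t0 : 0 < N / 2 :> R by rewrite divr_gt0.
  apply: le_trans (@subset_mean_markov _ _ (vertex_pairs n) _ q01 (b K)
    (fun E => N / 2 <= b K E) _ t0 _ _) _ => //.
  rewrite ler_pdivrMr//; apply: le_trans (mean_bcount_le q01 D2 K) _.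
  by rewrite le_eqVlt; apply/orP; left; apply/eqP; field; rewrite gt_eqF.
- have t0 : 0 < (sig * N) ^+ 2 by rewrite exprn_gt0.
  apply: le_trans (@subset_mean_markov _ _ (vertex_pairs n) _ q01
    (fun E => (u K.+1 E - u K E * m K E) ^+ 2)
    (fun E => (sig * N) ^+ 2 <= (u K.+1 E - u K E * m K E) ^+ 2)
    _ t0 _ _) _ => //.
    by move=> E; rewrite sqr_ge0.
  rewrite ler_pdivrMr//; apply: le_trans (mean_noise_sqr_le K) _.
  by rewrite le_eqVlt; apply/orP; left; apply/eqP; field; rewrite !gt_eqF.
Qed.

Hypothesis eps0 : 0 < eps.

(** Truncate to the adapted event that the sphere of radius [K.+1] has at least [sig * N] vertices:
    there [miss] is at most [expR (- (sig * D))], and Markov's inequality at level [eps * N]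
    applies. *)
Lemma prob_uncount_gt :
  Ex (fun E => (eps * N < u K.+2 E)%R%:R) <=
  2 * zeta + 4 * (D ^+ K / N) + 1 / (sig ^+ 2 * N) + expR (- (sig * D)) / eps.
Proof.
have /andP[q0 q1] := q01.
have eN : 0 < eps * N by rewrite mulr_gt0.
pose G E : R := (sig * N <= s K.+1 E)%R%:R.
apply: le_trans (_ : _ <= Ex (fun E => (s K.+1 E < sig * N)%R%:R) +
    (eps * N)^-1 * Ex (fun E => G E * u K.+2 E)) _.
  rewrite -subset_meanZ -subset_meanD; apply: le_subset_mean => // E.
  have u0 := uncount_ge0 R K.+2 E.
  rewrite /G; have [h|h] := lerP (sig * N) (s K.+1 E); last first.
    by rewrite mul0r mulr0 addr0 lern1 leq_b1.
  rewrite mul1r add0r; have [h2|h2] := ltrP (eps * N) (u K.+2 E); last first.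
    by rewrite mulr_ge0// invr_ge0 ltW.
  by rewrite mulrC ler_pdivlMr// mul1r ltW.
apply: lerD; first exact: prob_scount_lt.
rewrite mulrC ler_pdivrMr// mean_uncountS; last first.
  exact: (adapted_comp (fun x => (sig * N <= x)%R%:R)) (adapted_scount _ _).
rewrite [leRHS]mulrA divfK ?gt_eqF// -[leRHS](subset_mean_cst (vertex_pairs n) q).
apply: le_subset_mean => // E; rewrite /G; have [h|h] := lerP (sig * N) (s K.+1 E); last first.
  by rewrite mul0r mulr_ge0 ?expR_ge0.
rewrite mul1r mulrC; apply: ler_pM.
- exact: miss_ge0.
- exact: uncount_ge0.
- apply: le_trans (miss_le_expR q01 _ _) _; rewrite ler_expR lerN2.
  by rewrite mulrA mulrC ler_wpM2l.
- exact: uncount_le.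
Qed.

(** * Geometric decay beyond radius [K.+2] *)

Local Notation rho := (D * eps).
Hypothesis rho2 : rho <= 1 / 2.

Let G (E : graph) : R := (u K.+2 E <= eps * N)%R%:R.

Let rho0 : 0 <= rho. Proof. by rewrite mulr_ge0 ?(D_ge0 D2)// ltW. Qed.

Let G0 E : 0 <= G E. Proof. exact: ler0n. Qed.

(** On the event [G], adapted from radius [K.+2] on, at most [eps * N] vertices remain to be
    reached, so each step multiplies the mean sphere size by at most [eps * N * q = rho]. *)
Lemma mean_far_scount_le i : Ex (fun E => G E * s (K.+2 + i)%N E) <= rho ^+ i * N.
Proof.
have /andP[q0 q1] := q01.
elim: i => [|i IH].
  rewrite expr0 mul1r addn0 -[leRHS](subset_mean_cst (vertex_pairs n) q).
  apply: le_subset_mean => // E; apply: le_trans (scount_le R K.+2 E).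
  by rewrite ler_piMl ?scount_ge0// lern1 leq_b1.
rewrite addnS mean_scountS; last first.
  exact: (adapted_comp (fun x => (x <= eps * N)%R%:R))
    (adapted_uncount _ (leq_addr _ _)).
rewrite exprS -mulrA; apply: le_trans (ler_wpM2l rho0 IH).
rewrite -subset_meanZ; apply: le_subset_mean => // E.
rewrite [leRHS]mulrCA /G; have [h|h] := lerP (u K.+2 E) (eps * N); rewrite ?mul0r// !mul1r.
rewrite (_ : rho * _ = (eps * N) * (q * s (K.+2 + i)%N E)); last by ring.
apply: ler_pM; rewrite ?uncount_ge0// ?subr_ge0 ?miss_le1//.
  by apply: le_trans h; apply: uncount_anti; rewrite leq_addr.
by have := miss_ge q01 (K.+2 + i)%N E; lra.
Qed.

(** A sum of spheres, dominated by a geometric series of ratio at most 1/2. The induction peels off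
    the nearest sphere, so [i] varies while [i + l] stays fixed. *)
Lemma mean_far_uncount_le i l :
  Ex (fun E => G E * (u (K.+2 + i)%N E - u (K.+2 + (i + l))%N E)) <=
  2 * rho ^+ i.+1 * N.
Proof.
elim: l i => [|l IH] i.
  under eq_subset_mean => E do rewrite addn0 subrr mulr0.
  by rewrite subset_mean_cst !mulr_ge0 ?exprn_ge0.
have -> : Ex (fun E => G E * (u (K.+2 + i)%N E - u (K.+2 + (i + l.+1))%N E)) =
    Ex (fun E => G E * s (K.+2 + i.+1)%N E) +
    Ex (fun E => G E * (u (K.+2 + i.+1)%N E - u (K.+2 + (i.+1 + l))%N E)).
  rewrite -subset_meanD; apply: eq_subset_mean => E.
  by rewrite [(K.+2 + i.+1)%N]addnS scountS addnS addSn; ring.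
apply: le_trans (lerD (mean_far_scount_le i.+1) (IH i.+1)) _.
rewrite -mulrDl ler_wpM2r ?ler0n// (exprS _ i.+1).
have : 0 <= (1 / 2 - rho) * rho ^+ i.+1 by rewrite mulr_ge0 ?subr_ge0 ?exprn_ge0.
by move: rho2 => h2 h; lra.
Qed.

Lemma mean_far_sum_le i l :
  Ex (fun E => G E *
    \sum_(k < l) (u (K.+2 + (i + k))%N E - u (K.+2 + (i + l))%N E)) <=
  4 * rho ^+ i.+1 * N.
Proof.
elim: l i => [|l IH] i.
  under eq_subset_mean => E do rewrite big_ord0 mulr0.
  by rewrite subset_mean_cst !mulr_ge0 ?exprn_ge0.
have -> : Ex (fun E => G E * \sum_(k < l.+1)
        (u (K.+2 + (i + k))%N E - u (K.+2 + (i + l.+1))%N E)) =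
    Ex (fun E => G E * (u (K.+2 + i)%N E - u (K.+2 + (i + l.+1))%N E)) +
    Ex (fun E => G E *
      \sum_(k < l) (u (K.+2 + (i.+1 + k))%N E - u (K.+2 + (i.+1 + l))%N E)).
  rewrite -subset_meanD; apply: eq_subset_mean => E.
  rewrite big_ord_recl/= addn0 -mulrDr; congr (_ * (_ + _)).
  by apply: eq_bigr => k _; rewrite /bump /= add1n !addnS !addSn.
apply: le_trans (lerD (mean_far_uncount_le i l.+1) (IH i.+1)) _.
rewrite -mulrDl ler_wpM2r ?ler0n// (exprS _ i.+1).
have : 0 <= (1 / 2 - rho) * rho ^+ i.+1 by rewrite mulr_ge0 ?subr_ge0 ?exprn_ge0.
by move: rho2 => h2 h; lra.
Qed.

(** Cut the sum over the radii below [M] into [k <= K], where [u k] is [N - b k], the single radius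
    [K.+1], which gives [lam * N], and the tail. The subtracted [u M] occurs [K.+2] times before the
    tail. *)
Lemma dist_sum_dev_le (E : graph) : u K.+2 E <= eps * N ->
  `|(dist_sum E)%:R - (K.+1%:R + lam) * N| <=
  \sum_(k < K.+1) b k E + K.+2%:R * (eps * N) + `|u K.+1 E - lam * N| +
  \sum_(k < #|V|) (u (K.+2 + k)%N E - u (K.+2 + #|V|)%N E).
Proof.
move=> ue.
rewrite (@dist_sumE R n (K.+2 + #|V|)%N) ?leq_addl//.
set M := (K.+2 + #|V|)%N; set T := \sum_(k < #|V|) _.
have uM : 0 <= u M E <= eps * N.
  by rewrite uncount_ge0 (le_trans _ ue)// uncount_anti// leq_addr.
have T0 : 0 <= T.
  apply: sumr_ge0 => k _; rewrite subr_ge0 uncount_anti//.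
  by rewrite leq_add2l ltnW.
have b0 : 0 <= \sum_(k < K.+1) b k E.
  by apply: sumr_ge0 => k _; exact: bcount_ge0.
have -> : \sum_(k < M) (u k E - u M E) =
    K.+1%:R * N - \sum_(k < K.+1) b k E - K.+2%:R * u M E + u K.+1 E + T.
  rewrite big_split_ord/= -/T; congr (_ + T); rewrite big_ord_recr/=.
  under eq_bigr => k _ do rewrite -[u k E](subKr N) -bcountE -addrA -opprD opprD.
  rewrite !big_split/= !sumr_const !card_ord sumrN -[K.+2]addn1 natrD.
  rewrite -[_%:R *+ _]mulr_natl -[(- u M E) *+ _]mulr_natl.
  move: (u M E) (u K.+1 E) (\sum_(i < K.+1) b i E).
  by move: (K.+1%:R) (n.-1.+1%:R) => *; ring.
clearbody T; clearbody M.
have -> : K.+1%:R * N - \sum_(k < K.+1) b k E - K.+2%:R * u M E + u K.+1 E + T -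
    (K.+1%:R + lam) * N =
    (- \sum_(k < K.+1) b k E - K.+2%:R * u M E) + (u K.+1 E - lam * N) + T.
  move: (u M E) (u K.+1 E) (\sum_(i < K.+1) b i E) (K.+1%:R) (K.+2%:R) => *.
  by ring.
apply: le_trans (ler_normD _ _) _; rewrite (ger0_norm T0) lerD2r.
apply: le_trans (ler_normD _ _) _; rewrite lerD2r -opprD normrN.
case/andP: uM => uM0 uM1.
by rewrite ger0_norm ?addr_ge0 ?mulr_ge0// lerD2l ler_wpM2l.
Qed.

(** Off the event [G] use [prob_uncount_gt]; on it use Markov's inequality. The balls below d* give
    [4 * D ^+ K] and the error in [u K.+1] another [2 * D ^+ K]. *)
Lemma prob_dist_sum_dev (t : R) : 0 < t ->
  Ex (fun E => (t < `|(dist_sum E)%:R - (K.+1%:R + lam) * N|)%R%:R) <=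
  2 * zeta + 4 * (D ^+ K / N) + 1 / (sig ^+ 2 * N) + expR (- (sig * D)) / eps +
  (6 * D ^+ K + K.+2%:R * (eps * N) + Num.sqrt N + D ^+ 2 + 2 * N * zeta +
   4 * rho * N) / t.
Proof.
move=> t0.
pose X (E : graph) := `|(dist_sum E)%:R - (K.+1%:R + lam) * N|.
apply: le_trans (_ : _ <= Ex (fun E => (eps * N < u K.+2 E)%R%:R) +
    t^-1 * Ex (fun E => G E * X E)) _.
  rewrite -subset_meanZ -subset_meanD; apply: le_subset_mean => // E.
  rewrite /G -/(X E); have [h|h] := lerP (u K.+2 E) (eps * N); last first.
    by rewrite mul0r mulr0 addr0 lern1 leq_b1.
  rewrite mul1r add0r; have [h2|h2] := ltrP t (X E); last first.
    by rewrite mulr_ge0 ?invr_ge0 ?normr_ge0// ltW.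
  by rewrite mulrC ler_pdivlMr// mul1r ltW.
apply: lerD; first exact: prob_uncount_gt.
rewrite mulrC; apply: ler_wpM2r; first by rewrite invr_ge0 ltW.
apply: le_trans (_ : _ <= Ex (fun E => \sum_(k < K.+1) b k E) +
    Ex (fun=> K.+2%:R * (eps * N)) + Ex (fun E => `|u K.+1 E - lam * N|) +
    Ex (fun E => G E * \sum_(k < #|V|)
      (u (K.+2 + (0 + k))%N E - u (K.+2 + (0 + #|V|))%N E))) _.
  rewrite -!subset_meanD; apply: le_subset_mean => // E.
  rewrite /G; have [h|h] := lerP (u K.+2 E) (eps * N).
    by rewrite !mul1r; exact: dist_sum_dev_le.
  rewrite !mul0r addr0; apply: addr_ge0; last exact: normr_ge0.
  apply: addr_ge0; first by apply: sumr_ge0 => k _; exact: bcount_ge0.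
  by rewrite !mulr_ge0// ltW.
have h1 := mean_far_sum_le 0 #|V|; have h2 := mean_uncount_dev_le.
have h3 := sum_mean_bcount_le q01 D2 K.
rewrite subset_mean_cst subset_mean_sum.
apply: le_trans (lerD (lerD (lerD h3 (lexx _)) h2) h1) _.
by rewrite expr1; lra.
Qed.

End DistanceSum.

(** * Asymptotics *)

Section Asymptotics.
Variable R : realType.

Lemma card_vertex n : (0 < n)%N -> #|vertex n| = n.
Proof. by move=> n0; rewrite card_ord prednK. Qed.

Lemma ER_probE n (q : R) (A : pred {set {set vertex n}}) :
  ER_prob q A = subset_mean (vertex_pairs n) q (fun E => (A E)%:R).
Proof.
rewrite /ER_prob big_mkcondr; apply: eq_bigr => E _.
by case: (A E); rewrite ?mulr1 ?mulr0.
Qed.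

(** Keep the term [x ^+ 6 / 720] of the exponential series, where 720 is the factorial of 6. *)
Lemma expR_ge_expr5 (x : R) : 720 <= x -> x ^+ 5 <= expR x.
Proof.
move=> x720; have x0 : 0 <= x by lra.
have := expR_ge1Dxn 5 x0; rewrite (_ : 6`! = 720%N)// => h.
apply: le_trans (_ : _ <= 1 + x ^+ 6 / 720) h.
have : x ^+ 5 * 720 <= x ^+ 6 by rewrite (exprSr x 5) ler_wpM2l ?exprn_ge0.
have : 0 <= x ^+ 5 by rewrite exprn_ge0.
by move=> *; lra.
Qed.

(** A quantitative form at fixed [n], with rate 1 / log log n; every requirement that [n] be large
    is a lower bound on [L]. *)
Lemma prob_dist_sum_dev_loglog (n : nat) (a c C delta lam : R) (d : int) :
  let l := ln n%:R in let L := ln l in let q := a * l / n%:R in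
  0 < delta -> 0 < c -> 0 < C -> c <= a -> a <= C ->
  720 <= L -> 48 <= c * L -> C ^+ 2 <= L -> 2 * C <= L -> expR 1 <= L ->
  is_dstar n q d -> 0 < lam -> ln (1 / lam) = (n%:R * q) ^ d / n%:R ->
  `|ER_prob q (fun E : {set {set vertex n}} =>
    delta < `|L / n%:R * `|(dist_sum E)%:R - (d%:~R + lam) * n%:R| |)| <=
  (22 + (27 + 4 * C) / delta) / L.
Proof.
move=> l L q delta0 c0 C0 ca aC L720 cL C2 CL eL dP lam0 lamE.
have L0 : 0 < L by lra.
(* [ln] takes the default value 0 on nonpositive arguments, so a positive logarithm forces a
   positive argument. *)
have l0 : 0 < l by rewrite ltNge; apply: contraL L0 => h; rewrite /L ln0// ltxx.
have n0 : 0 < n%:R :> R.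
  by rewrite ltNge; apply: contraL l0 => h; rewrite /l ln0// ltxx.
have lE : expR L = l by rewrite lnK.
have nE : expR l = n%:R by rewrite lnK.
have L5l : L ^+ 5 <= l by rewrite -lE expR_ge_expr5.
have L1 : 1 <= L by lra.
have powL i j : (i <= j)%N -> L ^+ i <= L ^+ j by move=> ij; rewrite ler_weXn2l.
have Ll : L <= l by apply: le_trans L5l; rewrite -[leLHS]expr1 powL.
have l1 : 1 <= l by lra.
have powl i j : (i <= j)%N -> l ^+ i <= l ^+ j by move=> ij; rewrite ler_weXn2l.
have l5n : l ^+ 5 <= n%:R by rewrite -nE expR_ge_expr5//; lra.
have nn : (0 < n)%N by rewrite -(ltr0n R).
have qE : n%:R * q = a * l by rewrite /q mulrC divfK// gt_eqF.
set D := a * l in qE *.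
have Dc : 48 * L ^+ 4 <= D.
  apply: le_trans (_ : _ <= c * L * L ^+ 4) _.
    by rewrite ler_wpM2r// exprn_ge0// ltW.
  rewrite -mulrA -exprS; apply: ler_pM => //; first exact: ltW.
  by rewrite exprn_ge0// ltW.
have DC : D <= C * l by rewrite ler_wpM2r// ltW.
have L41 : 1 <= L ^+ 4 by rewrite exprn_ege1.
have D48 : 48 <= D by lra.
have q01 : 0 <= q <= 1.
  rewrite (_ : q = D / n%:R)//; apply/andP; split.
    by rewrite divr_ge0 ?ltW//; lra.
  rewrite ler_pdivrMr// mul1r; apply: le_trans DC _; apply: le_trans l5n.
  apply: le_trans (_ : _ <= l ^+ 2) _; last exact: powl.
  by rewrite expr2 ler_wpM2r ?ltW//; lra.
have L2n : L ^+ 2 < n%:R.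
  apply: lt_le_trans (_ : _ < l ^+ 2) _; last exact: le_trans (powl 2 5 _) l5n.
  rewrite ltrXn2r// ?ltW//; apply: lt_le_trans L5l.
  by rewrite -[ltLHS]expr1 ltr_eXn2l//; lra.
have L20 : 0 < L ^+ 2 by rewrite exprn_gt0.
case: dP; rewrite /= qE -/l -/L => dD dmin.
(* The threshold exceeds 1, whereas a nonpositive power of [D] is at most 1. *)
have [K dE] : exists K : nat, d = K.+1.
  have n1 : 1 < n%:R / L ^+ 2 by rewrite ltr_pdivlMr// mul1r.
  case: d dD {dmin lamE} => [[|K]|K]; last 2 first.
  - by exists K.
  - move=> /(lt_le_trans n1); rewrite NegzE -exprnN.
    by rewrite ltNge invf_le1 ?exprn_gt0 ?exprn_ege1//; lra.
  - by move=> /(lt_le_trans n1); rewrite -exprnP expr0 ltxx.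
(* Minimality of [d]: the exponent [K] misses the threshold. *)
have kappa : D ^+ K / n%:R <= L ^- 2.
  rewrite leNgt; apply/negP => h.
  have /dmin : n%:R / L ^+ 2 <= D ^ K by rewrite -exprnP mulrC -ler_pdivlMr// ltW.
  by rewrite dE lez_nat ltnn.
have DK : n%:R / L ^+ 2 <= D ^+ K.+1 by move: dD; rewrite dE -exprnP.
(* Since [expR 1 <= D], [expR K%:R] is at most [D ^+ K], hence at most [n]. *)
have Kl : K%:R <= l.
  rewrite -ler_expR nE -[X in expR X]mulr1 expRM_natl.
  apply: le_trans (_ : _ <= D ^+ K) _.
    rewrite lerXn2r ?nnegrE ?expR_ge0//; first by lra.
    apply: le_trans eL _; apply: le_trans (_ : _ <= L ^+ 4) _; last by lra.
    by rewrite -[leLHS]expr1 powL.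
  have : D ^+ K <= L ^- 2 * n%:R by rewrite -ler_pdivrMr.
  move=> /le_trans; apply; rewrite ler_piMl ?ler0n// invf_le1// exprn_ege1//.
set w := Num.sqrt D.
have wD : w ^+ 2 = #|vertex n|%:R * q by rewrite card_vertex// qE sqr_sqrtr//; lra.
have wL : L ^+ 2 <= w.
  rewrite -[leLHS]ger0_norm ?sqr_ge0// -sqrtr_sqr ler_wsqrtr// -exprM; lra.
have w2 : 2 <= w by apply: le_trans wL; have := powL 1%N 2%N isT; rewrite expr1; lra.
set i := L^-1.
have i0 : 0 < i by rewrite invr_gt0.
have i1 : i <= 1 by rewrite invf_le1.
have iL : i * L = 1 by rewrite mulVf// gt_eqF.
have i2E : i ^+ 2 = L ^- 2 by rewrite exprVn.
have i20 : 0 <= i ^+ 2 by rewrite sqr_ge0.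
have i2i : i ^+ 2 <= i by rewrite expr2 ler_piMl// ltW.
have leI (x y : R) : 0 < y -> x * L ^+ 2 <= y -> x / y <= i ^+ 2.
  by move=> y0 xy; rewrite i2E ler_pdivrMr// mulrC ler_pdivlMr.
(* [sig] is the largest value allowed by [16 * sig <= L ^- 2], which the threshold for [d]
   guarantees. [eps] makes both [D * eps] and [K * eps] of order [1 / l]. *)
pose sig := i ^+ 2 / 16; pose eps := l ^- 2.
have sig0 : 0 < sig by rewrite divr_gt0// exprn_gt0.
have sig1 : 8 * sig <= 1 by rewrite /sig; lra.
have eps0 : 0 < eps by rewrite invr_gt0 exprn_gt0.
have L2l : L ^+ 2 <= l by apply: le_trans L5l; exact: powL.
have lI : l^-1 <= i ^+ 2 by rewrite -[leLHS]mul1r leI// mul1r.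
have epsE : l * eps = l^-1 by rewrite /eps expr2 invfM mulrA mulfV ?mul1r// gt_eqF.
have lV0 : 0 <= l^-1 by rewrite invr_ge0 ltW.
have Deps : D * eps <= C * i ^+ 2.
  apply: le_trans (_ : _ <= C * (l * eps)) _.
    by rewrite mulrA ler_wpM2r// ltW.
  by rewrite epsE ler_wpM2l// ltW.
have rho2 : D * eps <= 1 / 2.
  apply: le_trans (_ : _ <= C * (l * eps)) _.
    by rewrite mulrA ler_wpM2r// ltW.
  by rewrite epsE ler_pdivrMr//; lra.
have lamE' : lam = expR (- (D ^+ K.+1 / n%:R)).
  move: lamE; rewrite qE dE -exprnP => <-.
  by rewrite div1r lnV ?posrE// opprK lnK.
have zeta : 2 / w + 6 * (D ^+ K / n%:R) <= 8 * i ^+ 2.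
  have : w^-1 <= i ^+ 2 by rewrite i2E lef_pV2// posrE; lra.
  by rewrite i2E; move: kappa => *; lra.
have h3 : 1 / (sig ^+ 2 * n%:R) <= i.
  rewrite ler_pdivrMr; last by rewrite mulr_gt0// exprn_gt0.
  have -> : i * (sig ^+ 2 * n%:R) = i ^+ 5 / 256 * n%:R by rewrite /sig; field.
  rewrite -ler_pdivrMl ?divr_gt0 ?exprn_gt0// mulr1 invf_div.
  rewrite -exprVn invrK; apply: le_trans l5n.
  apply: le_trans (_ : _ <= l ^+ 2) _; last exact: powl.
  rewrite expr2; apply: ler_pM => //; first by rewrite exprn_ge0// ltW.
  by lra.
(* [sig * D] is at least [3 * L], so the exponential is at most [l ^- 3 = eps / l]. *)
have h4 : expR (- (sig * D)) / eps <= i.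
  have sD : 3 * L <= sig * D.
    apply: le_trans (_ : _ <= sig * (48 * L ^+ 4)) _; last by rewrite ler_wpM2l// ltW.
    rewrite (_ : sig * _ = 3 * (i * L) ^+ 2 * L ^+ 2); last by rewrite /sig; field.
    by rewrite iL expr1n mulr1 expr2; nra.
  rewrite ler_pdivrMr//; apply: le_trans (_ : _ <= expR (- (3 * L))) _.
    by rewrite ler_expR lerN2.
  rewrite expRN expRM_natl lE /eps (exprS l 2) invfM.
  apply: ler_wpM2r; first by rewrite invr_ge0 exprn_ge0// ltW.
  by rewrite lef_pV2 ?posrE.
pose t := delta * n%:R / L.
have t0 : 0 < t by rewrite divr_gt0// mulr_gt0.
rewrite ER_probE ger0_norm; last by apply: subset_mean_ge0.
have card_n : #|vertex n| = n by exact: card_vertex.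
have := @prob_dist_sum_dev R n q w lam sig eps K q01 w2 wD.
rewrite card_n qE => /(_ lamE' sig0 sig1).
have sigD : 16 * sig <= D ^+ K.+1 / n%:R.
  rewrite /sig (_ : 16 * (i ^+ 2 / 16) = i ^+ 2); last by field.
  by rewrite i2E ler_pdivlMr// mulrC.
move=> /(_ sigD eps0 rho2 _ t0) bound.
apply: le_trans (_ : _ <= subset_mean (vertex_pairs n) q (fun E =>
    (t < `|(dist_sum E)%:R - (K.+1%:R + lam) * n%:R|)%R%:R)) _.
  apply: le_subset_mean => // E; rewrite dE.
  set Y := `|_ - _|.
  have Y0 : 0 <= Y by exact: normr_ge0.
  rewrite ler_nat; have [h|//] := ltrP delta `|_|.
  rewrite lt0b; move: h; rewrite ger0_norm; last first.
    by rewrite mulr_ge0// divr_ge0// ltW.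
  rewrite /t ltr_pdivrMr// => h.
  by move: h; rewrite mulrAC ltr_pdivlMr// mulrC [Y * _]mulrC mulrC.
apply: le_trans bound _.
(* In units of [i ^+ 2 * n] the terms are at most 6, 3, 1, 1, 16 and [4 * C]. Division by
   [t = delta * n / L] leaves one factor [i]. *)
have h5 : (6 * D ^+ K + K.+2%:R * (eps * n%:R) + Num.sqrt n%:R + D ^+ 2 +
    2 * n%:R * (2 / w + 6 * (D ^+ K / n%:R)) + 4 * (D * eps) * n%:R) / t <=
    (27 + 4 * C) / delta * i.
  have -> : (27 + 4 * C) / delta * i = (27 + 4 * C) * i ^+ 2 * n%:R / t.
    by rewrite /t /i; field; rewrite !gt_eqF.
  apply: ler_wpM2r; first by rewrite invr_ge0 ltW.
  have e1 : D ^+ K <= i ^+ 2 * n%:R by rewrite i2E -ler_pdivrMr.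
  have e2 : K.+2%:R * (eps * n%:R) <= 3 * (i ^+ 2 * n%:R).
    rewrite mulrA (mulrA 3) ler_wpM2r ?ler0n//.
    apply: le_trans (_ : _ <= 3 * l * eps) _.
      by apply: ler_wpM2r; [exact: ltW|rewrite -[K.+2]addn2 natrD; lra].
    by rewrite -mulrA epsE; lra.
  have e3 : Num.sqrt n%:R <= i ^+ 2 * n%:R.
    rewrite -{2}[n%:R]sqr_sqrtr ?ler0n//.
    have r0 : 0 < Num.sqrt n%:R :> R by rewrite sqrtr_gt0.
    rewrite [X in _ * X]expr2 mulrA; apply: ler_peMl; [exact: ltW|rewrite i2E].
    rewrite mulrC ler_pdivlMr// mul1r.
    rewrite -[leLHS]ger0_norm ?sqr_ge0// -sqrtr_sqr ler_wsqrtr// -exprM.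
    apply: le_trans l5n; apply: le_trans (powL 4%N 5%N isT) _.
    by apply: le_trans L5l _; rewrite -[leLHS]expr1 powl.
  have e4 : D ^+ 2 <= i ^+ 2 * n%:R.
    rewrite i2E mulrC ler_pdivlMr//.
    apply: le_trans l5n; apply: le_trans (_ : _ <= (L * l ^+ 2) * L ^+ 2) _.
      rewrite ler_wpM2r ?sqr_ge0//.
      apply: le_trans (_ : _ <= (C * l) ^+ 2) _.
        rewrite lerXn2r ?nnegrE//; first by lra.
        by apply: mulr_ge0; exact: ltW.
      by rewrite exprMn ler_wpM2r ?sqr_ge0.
    rewrite (_ : L * l ^+ 2 * L ^+ 2 = l ^+ 2 * L ^+ 3); last by ring.
    apply: le_trans (_ : _ <= l ^+ 2 * l) _; last by rewrite -exprSr powl.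
    by rewrite ler_wpM2l ?sqr_ge0//; exact: le_trans (powL 3%N 5%N isT) L5l.
  have e5 : 2 * n%:R * (2 / w + 6 * (D ^+ K / n%:R)) <= 16 * (i ^+ 2 * n%:R).
    have := ler_wpM2l (ler0n R n) zeta; lra.
  have e6 : 4 * (D * eps) * n%:R <= 4 * C * (i ^+ 2 * n%:R).
    have := ler_wpM2r (ler0n R n) Deps; lra.
  by lra.
have k4 : 4 * (D ^+ K / n%:R) <= 4 * i ^+ 2 by rewrite i2E; lra.
(* The constant 22 is 16 from [2 * zeta], 4 from [k4], and 1 each from [h3] and [h4]. *)
rewrite -/i [leRHS]mulrDl; apply: lerD => //.
by lra.
Qed.

End Asymptotics.

(** * Passage to the limit *)

Local Open Scope classical_set_scope.
Local Open Scope ring_scope.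

Lemma limn_esup_lt_near (R : realType) (u : nat -> \bar R) (x : \bar R) :
  (limn_esup u < x)%E ->
  exists2 y, (y < x)%E & \forall n \near \oo, (u n <= y)%E.
Proof.
move=> /ereal_inf_lt[_ [A ooA <-] yx]; exists (ereal_sup (u @` A)) => //.
by apply: filterS ooA => n An; apply: ereal_sup_ubound; exists n.
Qed.

Lemma limn_esup_ltoo_bounded (R : realType) (u : nat -> R) :
  (limn_esup (fun n => (u n)%:E) < +oo)%E ->
  exists2 C, 0 < C & \forall n \near \oo, u n <= C.
Proof.
move=> /limn_esup_lt_near[y yoo uy].
exists (Num.max 1 (fine y)); first by rewrite lt_max ltr01.
apply: filterS uy => n; rewrite le_max; case: y yoo => [r| |] //=.
by move=> _; rewrite lee_fin => ->; rewrite orbT.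
Qed.

Lemma limn_einf_gt0_bounded (R : realType) (u : nat -> R) :
  (0 < limn_einf (fun n => (u n)%:E))%E ->
  exists2 c, 0 < c & \forall n \near \oo, c <= u n.
Proof.
rewrite /limn_einf oppe_gt0 => /limn_esup_lt_near[y y0 uy].
case: y y0 uy => [r| |] //=; rewrite ?lte_fin => y0 uy.
  exists (- r); first by rewrite oppr_gt0.
  by apply: filterS uy => n /=; rewrite lee_fin lerNl.
(* Here [y] is minus infinity and the eventual bound is contradictory, so any positive constant
   serves. *)
by exists 1 => //; apply: filterS uy => n.
Qed.

Lemma near_ln_ln_ge (R : realType) (A : R) :
  \forall n \near \oo, A <= ln (ln n%:R).
Proof.
apply: filterS (nbhs_infty_ger (expR (expR A))) => n nA.
have n0 : 0 < n%:R :> R by exact: lt_le_trans (expR_gt0 _) nA.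
have lA : expR A <= ln n%:R by rewrite -ler_expR lnK.
have l0 : 0 < ln n%:R :> R by exact: lt_le_trans (expR_gt0 _) lA.
by rewrite -ler_expR lnK.
Qed.

Theorem theorem6p3 (R : realType) (alpha : nat -> R)
    (dstar : nat -> int) (lambda : nat -> R)
    (alpha_gt0 : forall n : nat, (0 < n)%N -> 0 < alpha n)
    (alpha_liminf : (0 < limn_einf (fun n => (alpha n)%:E))%E)
    (alpha_limsup : (limn_esup (fun n => (alpha n)%:E) < +oo)%E)
    (dstarP : \forall n \near \oo, is_dstar n (edge_prob alpha n) (dstar n))
    (lambdaP : \forall n \near \oo,
        [/\ 0 < lambda n, lambda n < 1 &
            ln (1 / lambda n) =
              (n%:R * edge_prob alpha n) ^ (dstar n) / n%:R]) :
  ER_cvg_in_prob0 (edge_prob alpha)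
    (fun n E => ln (ln n%:R) / n%:R *
       `|(dist_sum E)%:R - ((dstar n)%:~R + lambda n) * n%:R|).
Proof.
move=> delta delta0.
have [c c0 calpha] := limn_einf_gt0_bounded alpha_liminf.
have [C C0 alphaC] := limn_esup_ltoo_bounded alpha_limsup.
apply/cvgr0Pnorm_le => tol tol0.
pose M := 22 + (27 + 4 * C) / delta.
have M0 : 0 < M by rewrite ltr_pwDl// divr_ge0//; lra.
near=> n.
(* All summands are nonnegative, so this one inequality yields every lower bound on log log n; the
   last summand brings the rate [M / L] below [tol]. *)
have LA : 720 + 48 / c + C ^+ 2 + 2 * C + expR 1 + M / tol <= ln (ln n%:R).
  by near: n; exact: near_ln_ln_ge.
have ca : c <= alpha n by near: n.
have aC : alpha n <= C by near: n.
have dn : is_dstar n (edge_prob alpha n) (dstar n) by near: n.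
have [lam0 lam1 lamE] : [/\ 0 < lambda n, lambda n < 1 &
    ln (1 / lambda n) =
      (n%:R * edge_prob alpha n) ^ (dstar n) / n%:R] by near: n.
have p1 : 0 < 48 / c by rewrite divr_gt0.
have p2 : 0 <= C ^+ 2 by exact: sqr_ge0.
have p3 := expR_gt0 (1 : R).
have p4 : 0 < M / tol by rewrite divr_gt0.
have L0 : 0 < ln (ln n%:R) :> R by lra.
have bound := @prob_dist_sum_dev_loglog R n (alpha n) c C delta (lambda n)
  (dstar n) delta0 c0 C0 ca aC.
have cL : 48 <= c * ln (ln n%:R) by rewrite mulrC -ler_pdivrMr//; lra.
apply: le_trans (bound _ _ _ _ _ dn lam0 lamE) _; [lra|exact: cL|lra|lra|lra|].
rewrite -/M ler_pdivrMr// mulrC -ler_pdivrMr//; lra.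
Unshelve. all: by end_near.
Qed.
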